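(* Let $G$ be a finite connected metric graph and let $U \subseteq G$ be a nonempty subset. If $\operatorname{Ext}(G,U)$ is not fully contained within the set of leaves of $G$ and $d_{GH}(G,U) < \frac{1}{12}\operatorname{sys}(G)$, then $d_{GH}(G,U) = d_H(G,U)$.
   Context: A finite connected metric graph $G$ is a (nonempty) compact length space in which every point $x$ has a neighbourhood isometric to a Euclidean cone over a finite set equipped with its natural intrinsic length metric (i.e. finitely many segments of equal length glued at a common endpoint, the tip), via an isometry mapping $x$ to the tip. The number of points of this finite set (the number of segments) is uniquely determined by $x$ and is called the degree of $x$ in $G$. A leaf of $G$ is a point of degree $1$. The systole $\operatorname{sys}(G)$ is the minimum length of a simple cycle in $G$, equivalently the minimal length of a non-contractible closed curve in $G$; if $G$ contains no such curve (i.e. $G$ is acyclic), then $\operatorname{sys}(G) = \infty$. The subset $U$ carries the metric restricted from $G$. $d_H(G,U)$ is the Hausdorff distance between $G$ and $U$ as subsets of $G$, so $d_H(G,U) = \sup_{x\in G}\operatorname{dist}(x,U)$, where $\operatorname{dist}(x,U) = \inf_{u\in U} d(x,u)$. $d_{GH}(G,U)$ is the Gromov--Hausdorff distance between the metric spaces $G$ and $U$: the infimum of the Hausdorff distances between $G'$ and $U'$ over all metric spaces $Z$ and all subspaces $G', U' \subseteq Z$ isometric to $G$ and $U$ respectively. The set of extremal points of $U$ within $G$ is $\operatorname{Ext}(G,U) := \{x \in G : \operatorname{dist}(x,U) = d_H(G,U)\}$. *)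

(* Defs.v *)
From HB Require Import structures.
From mathcomp Require Import all_boot all_order all_algebra.
From mathcomp Require Import all_classical all_reals all_analysis.
From mathcomp Require Import lra.

Set Implicit Arguments.
Unset Strict Implicit.
Unset Printing Implicit Defensive.

Import Order.TTheory GRing.Theory Num.Theory.
Import numFieldNormedType.Exports.

Local Open Scope classical_set_scope.
Local Open Scope ring_scope.

Section length.
Context {R : realType} {X : metricType R}.
Implicit Types (c : R -> X) (x y : X).

Definition curve_length (a b : R) c : \bar R :=
  ereal_sup [set (\sum_(0 <= k < size s)
                    mdist (c (nth b (a :: s) k)) (c (nth b (a :: s) k.+1)))%:E
            | s in itv_partition a b].

(* Curves are total functions on R of which only the restriction to [0, 1]
   matters. *)
Definition curve c := {within `[0, 1], continuous c}.

Definition curve_from_to x y c := [/\ curve c, c 0 = x & c 1 = y].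

Definition simple_closed_curve c :=
  [/\ curve c, c 0 = c 1 & set_inj `[0, 1[ c].

End length.

Definition length_space {R : realType} (X : metricType R) :=
  forall x y : X,
    (mdist x y)%:E = ereal_inf [set curve_length 0 1 c | c in curve_from_to x y].

Definition is_isometry {R : realType} {X Y : metricType R}
    (A : set X) (B : set Y) (f : X -> Y) :=
  {in A &, forall x y, mdist (f x) (f y) = mdist x y} /\ f @` A = B.

(* The Euclidean cone over 'I_n, truncated at radius r: None is the tip and
   Some (i, t) is the point at distance t from the tip on the i-th segment. *)
Definition star {R : realType} (n : nat) (r : R) : Type :=
  option ('I_n * {t : R | 0 < t <= r}).

Section star.
Context {R : realType} (n : nat) (r : R).
Implicit Types p q : star n r.

Definition tip : star n r := None.

Definition star_dist p q : R :=
  match p, q with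
  | None, None => 0
  | None, Some (_, t) => sval t
  | Some (_, s), None => sval s
  | Some (i, s), Some (j, t) =>
      if i == j then `|sval s - sval t| else sval s + sval t
  end.

Let star_distxx p : star_dist p p = 0.
Proof. by case: p => [[i s]|] //=; rewrite eqxx subrr normr0. Qed.

Let sval_gt0 (t : {t : R | 0 < t <= r}) : 0 < sval t.
Proof. by case/andP: (valP t). Qed.

Let star_dist_positivity p q : star_dist p q = 0 -> p = q.
Proof.
case: p q => [[i s]|] [[j t]|] //=.
- case: eqP => [->|_].
    by move/normr0_eq0/eqP; rewrite subr_eq0 => /eqP/val_inj ->.
  by move/eqP; rewrite gt_eqF// addr_gt0 ?sval_gt0.
- by move/eqP; rewrite gt_eqF// sval_gt0.
- by move/eqP; rewrite gt_eqF// sval_gt0.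
Qed.

Let star_dist_sym p q : star_dist p q = star_dist q p.
Proof.
case: p q => [[i s]|] [[j t]|] //=.
by rewrite eq_sym distrC [sval s + sval t]addrC.
Qed.

Let star_dist_triangle q p u : star_dist p u <= star_dist p q + star_dist q u.
Proof.
case: p q u => [[i s]|] [[j t]|] [[k w]|] //=.
- move: (sval_gt0 s) (sval_gt0 t) (sval_gt0 w).
  move: (sval s) (sval t) (sval w) => a b c a0 b0 c0.
  case: (eqVneq i j) => [?|ij]; case: (eqVneq j k) => [?|jk]; subst;
    rewrite ?eqxx ?(negbTE ij) ?(negbTE jk) //; try case: (eqVneq i k) => _;
    by repeat case: ger0P => ?; lra.
- move: (sval_gt0 s) (sval_gt0 t); move: (sval s) (sval t) => a b a0 b0.
  by case: eqP => _; repeat case: ger0P => ?; lra.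
- move: (sval_gt0 s) (sval_gt0 w); move: (sval s) (sval w) => a c a0 c0.
  by case: eqP => _; repeat case: ger0P => ?; lra.
- by rewrite addr0.
- move: (sval_gt0 t) (sval_gt0 w); move: (sval t) (sval w) => b c b0 c0.
  by case: eqP => _; repeat case: ger0P => ?; lra.
- by move: (sval_gt0 t); move: (sval t) => b; lra.
- by rewrite add0r.
Qed.

HB.instance Definition _ := Choice.on (star n r).
HB.instance Definition _ := isMetric.Build R (star n r)
  star_distxx star_dist_positivity star_dist_sym star_dist_triangle.

End star.

Section graph.
Context {R : realType} (G : metricType R).

(* n = 0 is allowed: it is the degree of the point in a one-point space. *)
Definition has_degree (x : G) (n : nat) :=
  exists (r : R) (V : set G) (f : star n r -> G),
    [/\ 0 < r, nbhs x V, is_isometry [set: star n r] V f & f (tip n r) = x].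

Definition leaves : set G := [set x | has_degree x 1].

Definition finite_connected_metric_graph :=
  [/\ [set: G] !=set0, compact [set: G], length_space G &
      forall x : G, exists n, has_degree x n].

Definition systole : \bar R :=
  ereal_inf [set curve_length 0 1 c | c in @simple_closed_curve R G].

End graph.
Arguments leaves {R} G _.

Section distances.
Context {R : realType}.

Lemma edist_mdist (X : metricType R) (x y : X) :
  edist (x, y) = (mdist x y)%:E.
Proof.
apply/eqP; rewrite eq_le; apply/andP; split.
  apply/lee_addgt0Pr => e e0; rewrite -EFinD.
  apply: edist_fin => /=; first by rewrite ltr_wpDl// mdist_ge0.
  by rewrite ballEmdist /= ltrDl.
apply: le_ereal_inf_tmp => _ [d [_ +] <-].
by rewrite ballEmdist /= lee_fin => /ltW.
Qed.

Lemma edist_infE (X : metricType R) (A : set X) (x : X) :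
  edist_inf A x = ereal_inf [set (mdist x a)%:E | a in A].
Proof.
by congr ereal_inf; apply: eq_imagel => a _; rewrite edist_mdist.
Qed.

(* Meant for nonempty sets: the suprema are taken in [-oo, +oo]. *)
Definition hausdorff_dist {X : metricType R} (A B : set X) : \bar R :=
  maxe (ereal_sup [set edist_inf B a | a in A])
       (ereal_sup [set edist_inf A b | b in B]).

Definition are_isometric {X Y : metricType R} (A : set X) (B : set Y) :=
  exists f : X -> Y, is_isometry A B f.

Definition gromov_hausdorff_dist {X Y : metricType R}
    (A : set X) (B : set Y) : \bar R :=
  ereal_inf [set d | exists (Z : metricType R) (A' B' : set Z),
    [/\ are_isometric A A', are_isometric B B' & d = hausdorff_dist A' B']].

Definition extremal_points {X : metricType R} (U : set X) : set X :=
  [set x | edist_inf U x = hausdorff_dist [set: X] U].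

End distances.

(* Main.v *)
(** Suppose [d_GH(G,U) < delta < h = d_H(G,U)].  A correspondence gives
    [f : G -> U] and [g : U -> G] distorting distances by less than [2 delta],
    with [g \o f] within [2 delta] of the identity.  We use mod 2 cohomology of
    Vietoris-Rips type: a cocycle at scale [s] assigns a bit to each pair of
    points at distance less than [s], additively on triples of diameter less
    than [s].  As [12 delta < sys(G)], triangles of side about [4 delta] are
    tripods, so small scale cocycles on [G] extend uniquely to scale
    [4 delta + tau], and only finitely many classes exist.  Pulling back along
    [f] is therefore an endomorphism of a finite set of classes.  It is
    surjective: push a cocycle to [U] along [g], spread it over the
    [delta]-neighbourhood of [U], and extend it to [G], which is possible as [G]
    is one-dimensional.  But it kills the class dual to crossing a non-leaf
    extremal point [p], because points of [U] at distance about [2 delta] are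
    joined by geodesics avoiding [p]; and this class is nonzero, because
    extremality lets each arm at [p] be joined to [U] off [p].  A surjective
    endomorphism of a finite set is injective: contradiction. *)

Require Import Defs.
From mathcomp Require Import all_boot all_order all_algebra.
From mathcomp Require Import all_classical all_reals all_analysis.
From mathcomp Require Import lra.

Set Implicit Arguments.
Unset Strict Implicit.
Unset Printing Implicit Defensive.

Import Order.TTheory GRing.Theory Num.Theory.
Import numFieldNormedType.Exports.

Local Open Scope classical_set_scope.
Local Open Scope ring_scope.

(** * Betweenness, compactness and the existence of geodesics *)

Definition between {R : realType} {G : metricType R} (x z y : G) :=
  mdist x z + mdist z y = mdist x y.

(** Pointwise form, which compactness yields directly; parametrised geodesics are recovered in
    [geodesic_through]. *)
Definition geodesic_space {R : realType} (G : metricType R) :=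
  forall (x y : G) t, 0 <= t <= mdist x y -> exists2 z, mdist x z = t & between x z y.

Section metric.
Context {R : realType} {G : metricType R}.
Implicit Types (x y z a b w : G) (s t r e : R).

Lemma mdist_abs_triangle x y z : `|mdist x y - mdist x z| <= mdist y z.
Proof.
move: (metric_triangle x y z) (metric_triangle x z y).
rewrite (metric_sym z y); case: ger0P; lra.
Qed.

Lemma between_sym x z y : between x z y -> between y z x.
Proof.
rewrite /between (metric_sym y z) (metric_sym z x) (metric_sym y x).
by move=> <-; rewrite addrC.
Qed.

Lemma between_start x y : between x x y.
Proof. by rewrite /between mdistxx; lra. Qed.

Lemma between_end x y : between x y y.
Proof. by rewrite /between mdistxx; lra. Qed.

Lemma between_le x z y : between x z y -> mdist x z <= mdist x y.
Proof. by rewrite /between; move: (mdist_ge0 z y); lra. Qed.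

Lemma between_trans x w z y : between x z y -> between x w z ->
  between x w y /\ between w z y.
Proof.
rewrite /between => h k.
by move: (metric_triangle x w y) (metric_triangle w z y); lra.
Qed.

(* Sequential compactness: approximate common zeros of a family of
   equi-Lipschitz functions accumulate at a common zero. *)
Lemma compact_common_zero (I : Type) (h : I -> G -> R) (k : R) :
  compact [set: G] ->
  (forall i a b, `|h i a - h i b| <= k * mdist a b) ->
  (forall e : R, 0 < e -> exists q, forall i, `|h i q| <= e) ->
  exists q, forall i, h i q = 0.
Proof.
move=> cG hk H.
have [u hu] : {u : nat -> G & forall n i, `|h i (u n)| <= n.+1%:R^-1}.
  apply: (@choice _ _ (fun n q => forall i, `|h i q| <= n.+1%:R^-1)) => n.
  by apply: H; rewrite invr_gt0.
have [q [_ qu]] := cG (u @ \oo) _ filterT.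
exists q => i; apply/normr0_eq0/eqP; rewrite eq_le normr_ge0 andbT.
apply/ler_addgt0Pl => e e0; rewrite addr0.
pose k' := Num.max k 0 + 1.
have k'0 : 0 < k' by rewrite /k' ltr_wpDl// le_max lexx orbT.
have kk' : k <= k' by rewrite /k' ler_wpDr// le_max lexx.
have [N _ HN] := near_infty_natSinv_lt (PosNum (divr_gt0 e0 (ltr0n R 2))).
have /(_ [set u n | n in [set n | (N <= n)%N]] (ball q (e / 2 / k'))) := qu.
case.
- by exists N => // n /= Nn; exists n.
- by apply: nbhsx_ballx; rewrite !divr_gt0.
move=> _ [[n /= Nn <-]]; rewrite ballEmdist /= ltr_pdivlMr// => qun.
rewrite -[h i q](subrK (h i (u n))) (le_trans (ler_normD _ _))//.
rewrite [leRHS]splitr lerD//; last exact/ltW/(le_lt_trans (hu n i))/(HN n Nn).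
apply: (le_trans (hk i _ _)); apply: le_trans (ltW qun).
by rewrite mulrC ler_wpM2l// mdist_ge0.
Qed.

(** Otherwise the complements [B s] of finite unions of balls generate a proper filter; but the ball
    of radius [t q] about a cluster point [q] is disjoint from [B [:: q]]. *)
Lemma compact_finite_subcover (t : G -> R) : compact [set: G] ->
  (forall x, 0 < t x) ->
  exists s : seq G, forall x, exists2 c, c \in s & mdist c x < t c.
Proof.
move=> cG t0; apply: contrapT => nfin.
pose B (s : seq G) := [set x | forall c, c \in s -> t c <= mdist c x].
pose F := filter_from [set: seq G] B.
have FF : ProperFilter F.
  apply: filter_from_proper; last first.
    move=> s _; apply: contrapT => /set0P/negP; rewrite negbK => /eqP Bs.
    apply: nfin; exists s => x; apply: contrapT => nx.
    suff : B s x by rewrite Bs.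
    by move=> c cs; rewrite leNgt; apply/negP => cx; apply: nx; exists c.
  apply: filter_from_filter; first by exists [::].
  move=> s1 s2 _ _; exists (s1 ++ s2) => // x Bx.
  by split=> c cs; apply: Bx; rewrite mem_cat cs ?orbT.
have [q [_ qF]] := cG F FF filterT.
have /(_ (B [:: q]) (ball q (t q))) := qF.
case; [by exists [:: q]|exact: nbhsx_ballx|].
move=> x [/(_ q)]; rewrite mem_head => /(_ isT) + qx.
by move: qx; rewrite ballEmdist/= => /lt_le_trans h /h; rewrite ltxx.
Qed.

Lemma curve_length_ge (c : R -> G) t : 0 <= t <= 1 ->
  ((mdist (c 0%R) (c t) + mdist (c t) (c 1%R))%:E <= curve_length 0 1 c)%E.
Proof.
move=> /andP[t0 t1].
have le1 : ((mdist (c 0%R) (c 1%R))%:E <= curve_length 0 1 c)%E.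
  apply: ereal_sup_ubound; exists [:: 1]; last by rewrite /= big_nat1.
  by apply: itv_partition1.
have [->|tn0] := eqVneq t 0; first by rewrite mdistxx add0r.
have [->|tn1] := eqVneq t 1; first by rewrite mdistxx addr0.
apply: ereal_sup_ubound; exists [:: t; 1]; last by rewrite /= big_nat_recr//= big_nat1.
by split => //=; rewrite lt_neqAle eq_sym tn0 t0 lt_neqAle tn1 t1.
Qed.

(** A curve of length below [mdist x y + e] passes, by the intermediate value theorem, through a
    point at distance [t] from [x] whose betweenness fails by less than [e]; compactness removes
    [e]. *)
Lemma compact_length_geodesic :
  compact [set: G] -> length_space G -> geodesic_space G.
Proof.
move=> cG lG x y t /andP[t0 td].
pose h (i : bool) z := if i then mdist x z - t else mdist z y - (mdist x y - t).
have [||q hq] := @compact_common_zero bool h 1 cG.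
- move=> [] a b; rewrite mul1r /h.
    rewrite [X in `|X|](_ : _ = mdist x a - mdist x b); last by lra.
    exact: mdist_abs_triangle.
  rewrite [X in `|X|](_ : _ = mdist a y - mdist b y); last by lra.
  rewrite (metric_sym a y) (metric_sym b y).
  exact: mdist_abs_triangle.
- move=> e e0.
  have : (ereal_inf [set curve_length 0 1 c | c in curve_from_to x y]
          < (mdist x y + e)%:E)%E by rewrite -lG lte_fin ltrDl.
  move=> /ereal_inf_lt[_ [c [cc c0 c1] <-]] cl.
  have [] := @IVT R (fun s => mdist x (c s)) 0 1 t ler01.
  + move=> s; apply/cvgrPdist_lt => d d0; near=> u.
    apply: (@le_lt_trans _ _ (mdist (c s) (c u))).
      exact: mdist_abs_triangle.
    by near: u; exact: (metricType_numDomainType.cvgr_dist_lt (cc s)).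
  + by rewrite c0 c1 mdistxx ge_min t0 /= le_max td orbT.
  move=> s; rewrite in_itv/= => s01 xs; exists (c s).
  have := le_lt_trans (curve_length_ge c s01) cl.
  rewrite lte_fin c0 c1 => ub.
  case; rewrite /h; first by rewrite xs subrr normr0 ltW.
  by have tri := metric_triangle x (c s) y; rewrite ger0_norm; lra.
exists q; first by have := hq true; rewrite /h /=; lra.
by rewrite /between; have := hq true; have := hq false; rewrite /h; lra.
Unshelve. all: by end_near. Qed.

End metric.

(** * Geodesics *)

Section geodesic.
Context {R : realType} {G : metricType R}.
Hypotheses (cG : compact [set: G]) (gG : geodesic_space G).
Implicit Types (x y z a b w : G) (s t r e : R).

(** Stands in for the connectedness of a geodesic: one walks from [x] to [y] in steps of at most
    [e / 2]. The points [a] and [b] may lie on different geodesics. *)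
Lemma between_locally_constant (T : Type) (c : G -> T) e x y : 0 < e ->
  (forall a b, between x a y -> between x b y -> mdist a b < e -> c a = c b) ->
  c x = c y.
Proof.
move=> e0 H.
suff K n z : between x z y -> mdist z y <= n%:R * (e / 2) -> c z = c y.
  apply: (K (Num.bound (mdist x y / (e / 2)))); first exact: between_start.
  rewrite -ler_pdivrMr ?divr_gt0// ltW// archi_boundP// divr_ge0 ?mdist_ge0//.
  by rewrite divr_ge0// ltW.
elim: n z => [|n ih] z xzy.
  rewrite mul0r => zy; congr c; apply: mdist_positivity.
  by apply/eqP; rewrite eq_le zy mdist_ge0.
rewrite -natr1 mulrDl mul1r => zy.
pose t := Num.min (e / 2) (mdist z y).
have [w zw zwy] : exists2 w, mdist z w = t & between z w y.
  by apply: gG; rewrite ge_min lexx orbT andbT le_min mdist_ge0 divr_ge0// ltW.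
have xwy : between x w y.
  exact/between_sym/(between_trans (between_sym xzy) (between_sym zwy)).1.
rewrite (H z w) ?ih//.
- move: zwy; rewrite /between zw /t.
  have n0 : 0 <= n%:R * (e / 2) by rewrite mulr_ge0// divr_ge0// ltW.
  by case: (leP (e / 2) (mdist z y)); lra.
- by rewrite zw /t; case: (leP (e / 2) (mdist z y)); lra.
Qed.

(** If [h] stayed more than [e] away from [v], the truth value of [h z < v] would be locally
    constant between [x] and [y]. So approximate solutions exist, and compactness gives an exact
    one. *)
Lemma between_value (h : G -> R) x y v :
  (forall a b, `|h a - h b| <= mdist a b) -> h x <= v <= h y ->
  exists2 q, between x q y & h q = v.
Proof.
move=> hL /andP[xv vy].
pose k (i : bool) q := if i then h q - v else mdist x q + mdist q y - mdist x y.
(* The betweenness defect is a sum of two 1-Lipschitz functions, whence the constant [2]. *)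
have [||q hq] := @compact_common_zero _ _ bool k 2 cG.
- move=> [] a b; rewrite /k.
    rewrite [X in `|X|](_ : _ = h a - h b); last by lra.
    by have := hL a b; have := mdist_ge0 a b; lra.
  rewrite [X in `|X|](_ : _ = (mdist x a - mdist x b) + (mdist y a - mdist y b)).
    apply: (le_trans (ler_normD _ _)).
    by have := mdist_abs_triangle x a b; have := mdist_abs_triangle y a b; lra.
  by rewrite (metric_sym a y) (metric_sym b y); lra.
- move=> e e0; apply: contrapT => nq.
  have far q : between x q y -> e < `|h q - v|.
    move=> xqy; rewrite ltNge; apply/negP => qe; apply: nq; exists q.
    by case; rewrite /k// xqy subrr normr0 ltW.
  suff : (h x < v) = (h y < v).
    have := far x (between_start _ _); have := far y (between_end _ _).
    by case: (ger0P (h x - v)) => ?; case: (ger0P (h y - v)) => ?;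
      case: (ltP (h x) v); case: (ltP (h y) v) => // *; lra.
  apply: (@between_locally_constant _ (fun z => h z < v) e) => // a b ha hb ab.
  move: (far a ha) (far b hb) (hL a b).
  rewrite ler_norml => + + /andP[].
  by case: (ltP (h a) v) => ?; case: (ltP (h b) v) => ? //;
    case: (ger0P (h a - v)); case: (ger0P (h b - v)); lra.
exists q; first by have := hq false; rewrite /k /between; lra.
by have := hq true; rewrite /k; lra.
Qed.

(** Zorn's lemma gives a maximal set through [x], [z] and [y] on which distances are differences of
    distances to [x]. By maximality these distances cover [[0, mdist x y]] and so parametrise a
    geodesic. *)
Lemma geodesic_through x z y : between x z y ->
  exists2 g : R -> G, [/\ g 0 = x, g (mdist x z) = z & g (mdist x y) = y] &
    forall s t, 0 <= s <= mdist x y -> 0 <= t <= mdist x y ->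
      mdist (g s) (g t) = `|s - t|.
Proof.
move=> xzy; pose d := mdist x y.
pose linear A := forall a b, A a -> A b -> mdist a b = `|mdist x a - mdist x b|.
pose base : set G := [set x; z; y].
have lbase : linear base.
  have xz := between_le xzy; move: (xzy); rewrite /between => e.
  have xz0 := mdist_ge0 x z; have xy0 := mdist_ge0 x y; have zy0 := mdist_ge0 z y.
  move=> a b [[->|->]|->] [[->|->]|->]; rewrite ?mdistxx ?subrr ?normr0 ?subr0 ?sub0r//
    ?(metric_sym z x) ?(metric_sym y x) ?(metric_sym y z); by case: ger0P; lra.
(* Adjoining [base] in the predicate, not to the sets, also covers the empty chain. *)
have [|A [lA mA]] := @Zorn_bigcup G [set A | linear (A `|` base)].
  move=> F FP Ftot a b [[X FX Xa]|Ba] [[Y FY Yb]|Bb].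
  - have [XY|YX] := Ftot _ _ FX FY.
      by apply: (FP _ FY); left => //; exact: XY.
    by apply: (FP _ FX); left => //; exact: YX.
  - by apply: (FP _ FX); [left|right].
  - by apply: (FP _ FY); [right|left].
  - exact: lbase.
pose A' := A `|` base.
have A'x : A' x by right; left; left.
have A'y : A' y by right; right.
have surj t : 0 <= t <= d -> exists2 a, A' a & mdist x a = t.
  move=> /andP[t0 td]; apply: contrapT => nA.
  have nt a : A' a -> mdist x a != t.
    by move=> A'a; apply/eqP => at_; apply: nA; exists a.
  pose Lo : set R := [set mdist x a | a in [set a | A' a /\ mdist x a < t]].
  pose Hi : set R := [set - mdist x a | a in [set a | A' a /\ t < mdist x a]].
  have Lo0 : has_sup Lo.
    split; last by exists t => _ [a [_ /ltW at_]] <-.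
    exists 0; exists x; last exact: mdistxx.
    split => //; rewrite mdistxx lt_neqAle t0 andbT.
    by have := nt x A'x; rewrite mdistxx eq_sym.
  have Hi0 : has_sup Hi.
    split; last by exists (- t) => _ [a [_ /ltW at_]] <-; rewrite lerN2.
    exists (- d); exists y => //; split => //.
    by rewrite lt_neqAle td andbT eq_sym; exact: nt.
  (* A point at height [t] between [a] just below and [b] just above has nearly the required
     distance to every point of [A']; compactness makes all of these exact at once. *)
  have [q hq] : exists q, forall i : {a | A' a},
      mdist q (sval i) - `|t - mdist x (sval i)| = 0.
    apply: (compact_common_zero (k := 1)) => // [[b A'b] p q /=|e e0].
      rewrite mul1r [X in `|X|](_ : _ = mdist b p - mdist b q).
        exact: mdist_abs_triangle.
      by rewrite (metric_sym p) (metric_sym q); lra.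
    have e20 : 0 < e / 2 by rewrite divr_gt0.
    have [_ [a [A'a ta] <-] loa] := sup_adherent e20 Lo0.
    have [_ [b [A'b tb] <-] hib] := sup_adherent e20 Hi0.
    have ab : mdist a b = mdist x b - mdist x a.
      by rewrite lA// distrC gtr0_norm// subr_gt0 (lt_trans ta).
    have [|q aq aqb] := @gG a b (t - mdist x a).
      by rewrite ab; apply/andP; split; lra.
    exists q => -[c A'c] /=.
    have ac := lA _ _ A'a A'c; have bc := lA _ _ A'b A'c.
    have tac := metric_triangle q a c; have tbc := metric_triangle q b c.
    have tca := metric_triangle a q c; have tcb := metric_triangle b q c.
    rewrite (metric_sym q a) in tac; rewrite (metric_sym b q) in tcb.
    move: aqb; rewrite /between aq ab => aqb.
    have [ct|ct|/eqP] := ltgtP (mdist x c) t; last by rewrite (negbTE (nt _ A'c)).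
    - have : mdist x c <= sup Lo by apply: sup_upper_bound => //; exists c.
      rewrite (gtr0_norm (x := t - _)) ?subr_gt0//.
      move: bc; rewrite gtr0_norm ?subr_gt0 ?(lt_trans ct tb)// => bc.
      case: (ger0P (mdist x a - mdist x c)) ac => ? ac;
      by case: (ger0P (mdist q c - _)); lra.
    - have : - mdist x c <= sup Hi by apply: sup_upper_bound => //; exists c.
      rewrite (ltr0_norm (x := t - _)) ?subr_lt0//.
      move: ac; rewrite ltr0_norm ?subr_lt0 ?(lt_trans ta ct)// => ac.
      case: (ger0P (mdist x b - mdist x c)) bc => ? bc;
      by case: (ger0P (mdist q c - _)); lra.
  have qE b : A' b -> mdist q b = `|t - mdist x b|.
    by move=> A'b; have := hq (exist _ b A'b); rewrite /=; lra.
  have xq : mdist x q = t.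
    by rewrite metric_sym qE// mdistxx subr0 ger0_norm.
  apply: (mA (A `|` [set q])).
    split; first by move=> a; left.
    by move=> /(_ q (or_intror erefl)) Aq; have := nt q (or_introl Aq); rewrite xq eqxx.
  have sub : (A `|` [set q]) `|` base `<=` A' `|` [set q].
    by move=> a [[Aa|->]|Ba]; [left; left|right|left; right].
  move=> a b /sub[A'a|->] /sub[A'b|->]; first exact: lA.
  - by rewrite metric_sym qE// xq distrC.
  - by rewrite qE// xq.
  - by rewrite mdistxx subrr normr0.
have [g hg] : {g : R -> G & forall t, 0 <= t <= d -> A' (g t) /\ mdist x (g t) = t}.
  apply: (@choice _ _ (fun t q => 0 <= t <= d -> A' q /\ mdist x q = t)) => t.
  have [/surj[a]|h] := boolP (0 <= t <= d); first by exists a.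
  by exists x.
have gE a : A' a -> mdist x a <= d -> g (mdist x a) = a.
  move=> A'a ad; have [|A'g eg] := hg (mdist x a); first by rewrite mdist_ge0.
  by apply: mdist_positivity; rewrite lA// eg subrr normr0.
exists g; first split.
- by rewrite -[in g _](mdistxx x) gE// mdistxx mdist_ge0.
- by rewrite gE// ?between_le//; right; left; right.
- by rewrite gE.
- by move=> s t /hg[A's es] /hg[A't et]; rewrite lA// es et.
Qed.

End geodesic.

(** * Simple closed curves and short triangles *)

Section arcs.
Context {R : realType} {G : metricType R}.
Implicit Types (g : R -> G) (s t l m : R).

(** Concatenated geodesics need not be isometric, but they stay 1-Lipschitz, which bounds their
    length by [l]. *)
Definition lipschitz_arc l g :=
  forall s t, 0 <= s -> s <= t -> t <= l -> mdist (g s) (g t) <= t - s.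

Definition injective_arc l g :=
  forall s t, 0 <= s -> s < t -> t <= l -> g s <> g t.

Definition concat l g1 g2 : R -> G := fun t => if t <= l then g1 t else g2 (t - l).

Lemma lipschitz_concat l m g1 g2 : 0 <= l -> g1 l = g2 0 ->
  lipschitz_arc l g1 -> lipschitz_arc m g2 ->
  lipschitz_arc (l + m) (concat l g1 g2).
Proof.
move=> l0 e h1 h2 s t s0 st tlm; rewrite /concat.
have [tl|lt] := leP t l; first by rewrite (le_trans st tl) h1.
have [sl|ls] := leP s l.
  apply: (le_trans (metric_triangle _ (g1 l) _)).
  have := h1 s l s0 sl (lexx _).
  by rewrite e => ?; have := h2 0 (t - l) (lexx _); rewrite subr0; lra.
by have := h2 (s - l) (t - l); lra.
Qed.

Lemma injective_concat l m g1 g2 :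
  injective_arc l g1 -> injective_arc m g2 ->
  (forall s t, 0 <= s <= l -> 0 <= t <= m -> g1 s = g2 t -> s = l /\ t = 0) ->
  injective_arc (l + m) (concat l g1 g2).
Proof.
move=> h1 h2 h s t s0 st tlm; rewrite /concat.
have [tl|lt] := leP t l; first by rewrite (ltW (lt_le_trans st tl)); exact: h1.
have [sl|ls] := leP s l; last by apply: h2; lra.
by move=> /h; rewrite s0 sl => /(_ isT) []; lra.
Qed.

Lemma curve_length_le_lipschitz (c : R -> G) (L : R) :
  (forall s t, 0 <= s -> s <= t -> t <= 1 -> mdist (c s) (c t) <= L * (t - s)) ->
  (curve_length 0 1 c <= L%:E)%E.
Proof.
move=> hc; apply: ge_ereal_sup => _ [s sp <-]; rewrite lee_fin.
suff H a : 0 <= a -> itv_partition a 1 s ->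
    \sum_(0 <= k < size s) mdist (c (nth 1 (a :: s) k)) (c (nth 1 (a :: s) k.+1))
    <= L * (1 - a).
  by have := H 0 (lexx _) sp; rewrite subr0 mulr1.
elim: s a {sp} => [|x s ih] a a0 /= sp.
  by rewrite big_geq// (itv_partition_nil sp) subrr mulr0.
rewrite big_nat_recl//=.
have ax : a < x by case: sp => /= /andP[].
have sx := itv_partition_cons sp.
have x1 := itv_partition_le sx.
have := ih x (le_trans a0 (ltW ax)) sx.
by have := hc a x a0 (ltW ax) x1; lra.
Qed.

Lemma systole_le_closed_arc (L : R) g : 0 < L -> lipschitz_arc L g ->
  g 0 = g L -> (forall s t, 0 <= s -> s < t -> t < L -> g s <> g t) ->
  (systole G <= L%:E)%E.
Proof.
move=> L0 gL ge ginj; pose c t := g (L * t).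
have cL s t : 0 <= s -> s <= t -> t <= 1 -> mdist (c s) (c t) <= L * (t - s).
  move=> s0 st t1; rewrite mulrBr gL//.
  - by rewrite mulr_ge0// ltW.
  - by rewrite ler_pM2l.
  - by rewrite ger_pMr.
apply: le_trans (curve_length_le_lipschitz cL).
apply: ereal_inf_lbound; exists c => //; split.
- apply/subspace_continuousP => s; rewrite /= in_itv/= => /andP[s0 s1].
  apply/metricType_numDomainType.cvgrPdist_lt => e e0.
  apply/nbhs_ballP; exists (e / L) => [|u]; first by rewrite /= divr_gt0.
  rewrite /ball /= ltr_pdivlMr// => su; rewrite in_itv/= => /andP[u0 u1].
  apply: le_lt_trans su; have [us|su] := leP u s.
    by rewrite metric_sym ger0_norm ?subr_ge0// mulrC cL.
  by rewrite ltr0_norm ?subr_lt0// opprB mulrC cL// ltW.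
- by rewrite /c mulr0 mulr1.
- have H s t : 0 <= s -> s < t -> t < 1 -> c s <> c t.
    move=> s0 st t1; apply: ginj; first by rewrite mulr_ge0// ltW.
      by rewrite ltr_pM2l.
    by rewrite gtr_pMr.
  move=> s t; rewrite !inE /= !in_itv/= => /andP[s0 s1] /andP[t0 t1] st.
  have [lt|lt|//] := ltgtP s t; first by case: (H s t).
  by case: (H t s).
Qed.

Lemma systole_le_two_arcs l m g1 g2 : 0 < l -> 0 < m ->
  lipschitz_arc l g1 -> lipschitz_arc m g2 ->
  injective_arc l g1 -> injective_arc m g2 ->
  g1 l = g2 0 -> g1 0 = g2 m ->
  (forall s t, 0 <= s <= l -> 0 <= t <= m -> g1 s = g2 t ->
     s = l /\ t = 0 \/ s = 0 /\ t = m) ->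
  (systole G <= (l + m)%:E)%E.
Proof.
move=> l0 m0 L1 L2 I1 I2 e1 e2 dis.
apply: (@systole_le_closed_arc _ (concat l g1 g2)).
- by rewrite addr_gt0.
- by apply: lipschitz_concat => //; exact: ltW.
- by rewrite /concat ltW// e2 gerDl leNgt m0/= addrAC subrr add0r.
- move=> s t s0 st tlm; rewrite /concat.
  have [tl|lt] := leP t l; first by rewrite (ltW (lt_le_trans st tl)); exact: I1.
  have [sl|ls] := leP s l; last by apply: I2; lra.
  by move=> /dis; rewrite s0 sl => /(_ isT) []; lra.
Qed.

(** The Lipschitz bounds make the coincidence set closed, so it contains its supremum. *)
Lemma last_coincidence l g1 g2 : 0 <= l ->
  lipschitz_arc l g1 -> lipschitz_arc l g2 -> g1 0 = g2 0 ->
  exists a, [/\ 0 <= a <= l, g1 a = g2 a &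
    forall t, 0 <= t <= l -> g1 t = g2 t -> t <= a].
Proof.
move=> l0 L1 L2 e; pose E : set R := [set t | 0 <= t <= l /\ g1 t = g2 t].
have E0 : E 0 by rewrite /E /= lexx.
have supE : has_sup E by split; [exists 0|exists l => t [/andP[]]].
have a0 : 0 <= sup E by exact: sup_upper_bound.
have al : sup E <= l by apply: ge_sup; [exists 0|move=> t [/andP[]]].
exists (sup E); split.
- by rewrite a0 al.
- apply/mdist_positivity/eqP; rewrite eq_le mdist_ge0 andbT.
  apply/ler_addgt0Pl => d d0; rewrite addr0.
  have d20 : 0 < d / 2 by rewrite divr_gt0.
  have [t Et dt] := sup_adherent d20 supE.
  have [/andP[t0 tl] et] := Et.
  have ta : t <= sup E by exact: sup_upper_bound.
  have h1 := L1 _ _ t0 ta al; have h2 := L2 _ _ t0 ta al.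
  have := metric_triangle (g1 (sup E)) (g1 t) (g2 (sup E)).
  by rewrite (metric_sym _ (g1 t)) {2}et; lra.
- by move=> t tl et; apply: sup_upper_bound.
Qed.

Definition isometric_arc l g :=
  forall s t, 0 <= s <= l -> 0 <= t <= l -> mdist (g s) (g t) = `|s - t|.

Lemma isometric_subarc l g a m : isometric_arc l g -> 0 <= a -> a + m <= l ->
  isometric_arc m (fun t => g (a + t)).
Proof.
move=> gl a0 aml s t /andP[s0 sm] /andP[t0 tm]; rewrite gl; try by apply/andP; split; lra.
by congr (`|_|); lra.
Qed.

Lemma isometric_revarc l g b m : isometric_arc l g -> b <= l -> m <= b ->
  isometric_arc m (fun t => g (b - t)).
Proof.
move=> gl bl mb s t /andP[s0 sm] /andP[t0 tm]; rewrite gl; try by apply/andP; split; lra.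
by rewrite distrC; congr (`|_|); lra.
Qed.

Lemma isometric_lipschitz l g : isometric_arc l g -> lipschitz_arc l g.
Proof.
move=> gl s t s0 st tl; rewrite gl; try by apply/andP; split; lra.
by rewrite distrC ger0_norm// subr_ge0.
Qed.

Lemma isometric_injective l g : isometric_arc l g -> injective_arc l g.
Proof.
move=> gl s t s0 st tl e; have : mdist (g s) (g t) = 0 by rewrite e mdistxx.
rewrite gl; try by apply/andP; split; lra.
by rewrite distrC gtr0_norm ?subr_gt0//; lra.
Qed.

Lemma isometric_start l g t : isometric_arc l g -> 0 <= t <= l -> mdist (g 0) (g t) = t.
Proof.
move=> gl /andP[t0 tl]; rewrite gl; try by apply/andP; split; lra.
by rewrite sub0r normrN ger0_norm.
Qed.

Lemma isometric_end l g t : isometric_arc l g -> 0 <= t <= l -> mdist (g t) (g l) = l - t.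
Proof.
move=> gl /andP[t0 tl]; rewrite gl; try by apply/andP; split; lra.
by rewrite distrC ger0_norm// subr_ge0.
Qed.

Lemma isometric_between l g t : isometric_arc l g -> 0 <= t <= l ->
  between (g 0) (g t) (g l).
Proof.
move=> gl tl; rewrite /between (isometric_start gl tl) (isometric_end gl tl).
by rewrite (isometric_start gl)//; case/andP: tl; lra.
Qed.

End arcs.

Section short_triangles.
Context {R : realType} {G : metricType R}.
Hypotheses (cG : compact [set: G]) (gG : geodesic_space G).
Implicit Types (x y z w : G).

(** Geodesics through distinct points at equal distance from [x] part and meet again, bounding a
    simple closed curve of length at most [2 * mdist x y]. *)
Lemma between_unique x y z w : ((2 * mdist x y)%:E < systole G)%E ->
  between x z y -> between x w y -> mdist x z = mdist x w -> z = w.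
Proof.
move=> sys xzy xwy; set t0 := mdist x z => zw.
have [g [g0 gz gy] gi] := geodesic_through cG gG xzy.
have [h [h0 hw hy] hi] := geodesic_through cG gG xwy.
rewrite -/t0 in gz; rewrite -zw in hw.
set d := mdist x y in gy gi hy hi sys *.
have t00 : 0 <= t0 by exact: mdist_ge0.
have t0d : t0 <= d by exact: between_le.
have sub (k : R -> G) : isometric_arc d k -> isometric_arc t0 k.
  by move=> kd s t /andP[s0 st] /andP[r0 rt]; apply: kd; apply/andP; split; lra.
apply: contrapT => nzw.
have [|||a [/andP[a0 at0] ea amax]] := @last_coincidence _ _ t0 g h t00.
- exact/isometric_lipschitz/sub.
- exact/isometric_lipschitz/sub.
- by rewrite g0 h0.
have dt0 : 0 <= d - t0 by lra.
(* Reversing both arcs turns the first meeting after [t0] into a last coincidence. *)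
have [|||b [/andP[b0 bt0] eb bmax]] :=
    @last_coincidence _ _ (d - t0) (fun s => g (d - s)) (fun s => h (d - s)) dt0.
- by apply: isometric_lipschitz; apply: (isometric_revarc gi); lra.
- by apply: isometric_lipschitz; apply: (isometric_revarc hi); lra.
- by rewrite subr0 gy hy.
have a_t0 : a < t0.
  rewrite lt_neqAle at0 andbT; apply/eqP => at_; apply: nzw.
  by rewrite -gz -hw -at_.
have b_t0 : b < d - t0.
  rewrite lt_neqAle bt0 andbT; apply/eqP => bt_; apply: nzw.
  by move: eb; rewrite bt_ (subKr d t0) gz hw.
have H := @systole_le_two_arcs _ _ (d - b - a) (d - b - a)
   (fun t => g (a + t)) (fun t => h (d - b - t)).
suff : (systole G <= (d - b - a + (d - b - a))%:E)%E.
  move=> /(lt_le_trans sys); rewrite lte_fin; lra.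
have gi' : isometric_arc (d - b - a) (fun t => g (a + t)).
  by apply: (isometric_subarc gi); lra.
have hi' : isometric_arc (d - b - a) (fun t => h (d - b - t)).
  by apply: (isometric_revarc hi); lra.
apply: H.
- lra.
- lra.
- exact: isometric_lipschitz.
- exact: isometric_lipschitz.
- exact: isometric_injective.
- exact: isometric_injective.
- have -> : a + (d - b - a) = d - b by lra.
  by rewrite subr0.
- by rewrite addr0 subKr.
move=> s t /andP[s0 sl] /andP[r0 rl] st.
(* Both geodesics are parametrised by the distance to [x], so a common point has the same parameter
   on each. *)
have st' : a + s = d - b - t.
  rewrite -(isometric_start gi (t := a + s)); last by apply/andP; split; lra.
  rewrite -(isometric_start hi (t := d - b - t)); last by apply/andP; split; lra.
  by rewrite st g0 h0.
rewrite -st' in st.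
have [le|lt] := leP (a + s) t0.
  by have := amax (a + s); rewrite st le andbT => /(_ _ erefl); lra.
have := bmax (d - (a + s)); rewrite subKr.
by move=> /(_ _ st); lra.
Qed.

(* The pairwise last common points of the sides either yield a median or
   bound a simple closed curve. *)
Lemma triangle_median x y z :
  ((mdist x y + mdist y z + mdist x z)%:E < systole G)%E ->
  exists w, [/\ between x w y, between y w z & between x w z].
Proof.
move=> sys.
have [g1 [g10 _ g1d] i1] := geodesic_through cG gG (between_start x y).
have [g2 [g20 _ g2d] i2] := geodesic_through cG gG (between_start y z).
have [g3 [g30 _ g3d] i3] := geodesic_through cG gG (between_start x z).
rewrite -!/(isometric_arc _ _) in i1 i2 i3.
move: (mdist_ge0 x y) (mdist_ge0 y z) (mdist_ge0 x z) => d10 d20 d30.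
move: (mdist x y) (mdist y z) (mdist x z) d10 d20 d30 g1d g2d g3d i1 i2 i3 sys.
move=> d1 d2 d3 d10 d20 d30 g1d g2d g3d i1 i2 i3 sys.
have sub l m g : isometric_arc m g -> 0 <= l <= m -> isometric_arc l (g : R -> G).
  by move=> kd lm s t /andP[s0 st] /andP[r0 rt]; apply: kd; apply/andP; split; lra.
have min0 (u v : R) : 0 <= u -> 0 <= v -> 0 <= Num.min u v by rewrite le_min => -> ->.
have minl (u v : R) : Num.min u v <= u by rewrite ge_min lexx.
have minr (u v : R) : Num.min u v <= v by rewrite ge_min lexx orbT.
(* Here [a], and below [b] and [c], are the distances from [x], [y] and [z] to the last common point
   of the two sides starting there. *)
have [||||a [/andP[a0 al] ea amax]] := @last_coincidence _ _ (Num.min d1 d3) g1 g3.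
- by rewrite min0.
- by apply: isometric_lipschitz; apply: (sub _ d1) => //; rewrite min0// ?minl ?minr.
- by apply: isometric_lipschitz; apply: (sub _ d3) => //; rewrite min0// ?minl ?minr.
- by rewrite g10 g30.
have [||||b [/andP[b0 bl] eb bmax]] :=
  @last_coincidence _ _ (Num.min d1 d2) (fun s => g1 (d1 - s)) g2.
- by rewrite min0.
- by apply: isometric_lipschitz; apply: (isometric_revarc i1).
- by apply: isometric_lipschitz; apply: (sub _ d2) => //; rewrite min0// ?minl ?minr.
- by rewrite subr0 g1d g20.
have [||||c [/andP[c0 cl] ec cmax]] :=
  @last_coincidence _ _ (Num.min d2 d3) (fun s => g2 (d2 - s)) (fun s => g3 (d3 - s)).
- by rewrite min0.
- by apply: isometric_lipschitz; apply: (isometric_revarc i2).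
- by apply: isometric_lipschitz; apply: (isometric_revarc i3).
- by rewrite !subr0 g2d g3d.
move: al bl cl; rewrite !le_min => /andP[a1 a3] /andP[b1 b2] /andP[c2 c3].
have bet1 t : 0 <= t -> t <= d1 -> between x (g1 t) y.
  by move=> ? ?; rewrite -g10 -g1d; apply: isometric_between => //; apply/andP.
have bet2 t : 0 <= t -> t <= d2 -> between y (g2 t) z.
  by move=> ? ?; rewrite -g20 -g2d; apply: isometric_between => //; apply/andP.
have bet3 t : 0 <= t -> t <= d3 -> between x (g3 t) z.
  by move=> ? ?; rewrite -g30 -g3d; apply: isometric_between => //; apply/andP.
have iso (g : R -> G) d t u v : isometric_arc d g -> 0 <= t -> t <= u -> u <= v ->
    v <= d -> between (g t) (g u) (g v).
  move=> gd t0 tu uv vd; rewrite /between.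
  rewrite !gd; try by apply/andP; split; lra.
  by rewrite !ler0_norm; lra.
have [ab|ab] := leP d1 (a + b).
  exists (g1 a); split; [exact: bet1| |by rewrite ea; apply: bet3].
  apply: (between_trans (bet2 _ b0 b2) _).1.
  by apply: between_sym; rewrite -g1d -eb; apply: (iso _ d1) => //; lra.
have [ac|ac] := leP d3 (a + c).
  exists (g1 a); split; [exact: bet1| |by rewrite ea; apply: bet3].
  have h : between y (g3 (d3 - c)) z by rewrite -ec; apply: bet2; lra.
  apply/between_sym/(between_trans (between_sym h) _).1.
  by apply: between_sym; rewrite -g3d ea; apply: (iso _ d3) => //; lra.
have [bc|bc] := leP d2 (b + c).
  exists (g2 b); split; [by rewrite -eb; apply: bet1; lra|exact: bet2|].
  have h : between x (g2 (d2 - c)) z by rewrite ec; apply: bet3; lra.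
  apply/between_sym/(between_trans (between_sym h) _).1.
  by apply: between_sym; rewrite -g2d; apply: (iso _ d2) => //; lra.
(* In the remaining case the middle pieces of the three sides are nondegenerate and meet only at
   their ends. *)
exfalso.
pose l1 := d1 - a - b; pose l2 := d2 - b - c; pose l3 := d3 - a - c.
pose h1 t := g1 (a + t); pose h2 t := g2 (b + t); pose h3 t := g3 (d3 - c - t).
have j1 : isometric_arc l1 h1 by apply: (isometric_subarc i1); rewrite /l1; lra.
have j2 : isometric_arc l2 h2 by apply: (isometric_subarc i2); rewrite /l2; lra.
have j3 : isometric_arc l3 h3 by apply: (isometric_revarc i3); rewrite /l3; lra.
have e12 : h1 l1 = h2 0.
  rewrite /h1 /h2 /l1 addr0 -eb.
  by have -> : a + (d1 - a - b) = d1 - b by lra.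
have e23 : h2 l2 = h3 0.
  rewrite /h3 /h2 /l2 subr0 -ec.
  by have -> : b + (d2 - b - c) = d2 - c by lra.
have e31 : h1 0 = h3 l3.
  rewrite /h3 /h1 /l3 addr0 ea.
  by have -> : d3 - c - (d3 - a - c) = a by lra.
have dis12 s t : 0 <= s <= l1 -> 0 <= t <= l2 -> h1 s = h2 t -> s = l1 /\ t = 0.
  rewrite /l1 /l2 => /andP[s0 sl] /andP[t0 tl] st.
  have e : d1 - (a + s) = b + t.
    rewrite -(isometric_end i1 (t := a + s)); last by apply/andP; split; lra.
    rewrite -(isometric_start i2 (t := b + t)); last by apply/andP; split; lra.
    by rewrite (st : g1 (a + s) = _) g1d g20 metric_sym.
  have : b + t <= b by apply: bmax; rewrite ?le_min -e ?subKr ?e//; lra.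
  by split; lra.
have dis13 s t : 0 <= s <= l1 -> 0 <= t <= l3 -> h1 s = h3 t -> s = 0 /\ t = l3.
  rewrite /l1 /l3 => /andP[s0 sl] /andP[t0 tl] st.
  have e : a + s = d3 - c - t.
    rewrite -(isometric_start i1 (t := a + s)); last by apply/andP; split; lra.
    rewrite -(isometric_start i3 (t := d3 - c - t)); last by apply/andP; split; lra.
    by rewrite (st : g1 (a + s) = _) g10 g30.
  have : a + s <= a by apply: amax; [rewrite le_min; lra|rewrite {2}e].
  by split; lra.
have dis23 s t : 0 <= s <= l2 -> 0 <= t <= l3 -> h2 s = h3 t -> s = l2 /\ t = 0.
  rewrite /l2 /l3 => /andP[s0 sl] /andP[t0 tl] st.
  have e : d2 - (b + s) = c + t.
    have -> : c + t = d3 - (d3 - c - t) by lra.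
    rewrite -(isometric_end i2 (t := b + s)); last by apply/andP; split; lra.
    rewrite -(isometric_end i3 (t := d3 - c - t)); last by apply/andP; split; lra.
    by rewrite (st : g2 (b + s) = _) g2d g3d.
  have e' : d3 - (c + t) = d3 - c - t by lra.
  have : c + t <= c.
    by apply: cmax; [rewrite le_min; lra|rewrite e' -e subKr].
  by split; lra.
suff : (systole G <= ((l1 + l2) + l3)%:E)%E.
  by move=> /(lt_le_trans sys); rewrite lte_fin /l1 /l2 /l3; lra.
apply: (@systole_le_two_arcs _ _ _ _ (concat l1 h1 h2) h3).
- by rewrite /l1 /l2; lra.
- by rewrite /l3; lra.
- apply: lipschitz_concat => //; try exact: isometric_lipschitz.
  by rewrite /l1; lra.
- exact: isometric_lipschitz.
- by apply: injective_concat => //; exact: isometric_injective.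
- exact: isometric_injective.
- have l20 : 0 < l2 by rewrite /l2; lra.
  by rewrite /concat gerDl leNgt l20/= addrAC subrr add0r.
- by rewrite /concat ifT// /l1; lra.
move=> s t /andP[s0 sl] tl; rewrite /concat; case: leP => sl1.
  by move=> /dis13; rewrite s0 sl1 => /(_ isT tl) [-> ->]; right.
move=> /dis23 []//; first by apply/andP; split; lra.
by move=> e ->; left; split => //; lra.
Qed.

End short_triangles.

(** * Cocycles at a scale *)

Section cocycles.
Context {R : realType} {G : metricType R}.
Implicit Types (x y z a b w : G) (r s e : R) (N : set G) (phi psi : G -> G -> bool).

Definition cocycle N s phi := forall x y z, N x -> N y -> N z ->
  mdist x y < s -> mdist y z < s -> mdist x z < s -> phi x y (+) phi y z = phi x z.

Definition cohomologous N s phi psi := exists c : G -> bool,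
  forall x y, N x -> N y -> mdist x y < s -> phi x y = psi x y (+) (c x (+) c y).

Lemma cocyclexx N s phi x : 0 < s -> cocycle N s phi -> N x -> phi x x = false.
Proof.
by move=> s0 h Nx; have := h x x x Nx Nx Nx; rewrite mdistxx addbb => /(_ s0 s0 s0).
Qed.

Lemma cocycle_sym N s phi x y : cocycle N s phi -> N x -> N y ->
  mdist x y < s -> phi x y = phi y x.
Proof.
move=> h Nx Ny xy; have s0 : 0 < s by rewrite (le_lt_trans (mdist_ge0 x y)).
have := h x y x Nx Ny Nx xy; rewrite metric_sym mdistxx => /(_ xy s0).
by rewrite (cocyclexx s0 h Nx); case: (phi x y) (phi y x) => [] [].
Qed.

Lemma cocycle_cone N s phi x a b : cocycle N s phi -> N x -> N a -> N b ->
  mdist x a < s -> mdist x b < s -> mdist a b < s -> phi x a (+) phi x b = phi a b.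
Proof.
move=> h Nx Na Nb xa xb ab; rewrite -(h x a b)//.
by rewrite addbA addbb.
Qed.

Lemma cocycle_path4 N s phi a b x y : cocycle N s phi -> N a -> N b -> N x -> N y ->
  mdist a x < s -> mdist b y < s -> mdist x y < s -> mdist a y < s -> mdist a b < s ->
  phi a b = phi x y (+) (phi a x (+) phi b y).
Proof.
move=> h Na Nb Nx Ny ax by_ xy ay ab.
rewrite -(h a y b)//; last by rewrite metric_sym.
rewrite -(h a x y)// (cocycle_sym h Ny Nb) 1?metric_sym//.
by rewrite -addbA addbC -addbA (addbC (phi b y)).
Qed.

Lemma cohomologous_sym N s phi psi : cohomologous N s phi psi -> cohomologous N s psi phi.
Proof. by move=> [c h]; exists c => x y Nx Ny xy; rewrite h// -addbA addbb addbF. Qed.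

Lemma cohomologous_trans N s psi phi chi : cohomologous N s phi psi ->
  cohomologous N s psi chi -> cohomologous N s phi chi.
Proof.
move=> [c h] [c' h']; exists (fun x => c x (+) c' x) => x y Nx Ny xy.
rewrite h// h'//.
by case: (chi x y) (c x) (c y) (c' x) (c' y) => [] [] [] [] [].
Qed.

Lemma cohomologousW N r s phi psi : r <= s -> cohomologous N s phi psi ->
  cohomologous N r phi psi.
Proof. by move=> rs [c h]; exists c => x y Nx Ny xy; apply/h/(lt_le_trans xy). Qed.

End cocycles.

(** * Extension and comparison of cocycles across scales *)

Section scales.
Context {R : realType} {G : metricType R}.
Hypotheses (cG : compact [set: G]) (gG : geodesic_space G).
Implicit Types (x y z a b w : G) (r s e : R) (phi psi : G -> G -> bool).

(** By [between_unique], [z] is the point at distance [mdist x z] from [x] on a geodesic to [w]. *)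
Lemma between_linear x y z w : ((2 * mdist x y)%:E < systole G)%E ->
  between x z y -> between x w y -> mdist x z <= mdist x w -> between x z w.
Proof.
move=> sys xzy xwy zw.
have [|v xv xvw] := @gG x w (mdist x z); first by rewrite mdist_ge0.
rewrite (between_unique cG gG sys xzy (z := z) (w := v))//.
exact: (between_trans xwy xvw).1.
Qed.

(** A primitive of [phi] along all geodesics from [x] to [y] at once. *)
Definition potential r phi x y (c : G -> bool) := forall a b,
  between x a y -> between x b y -> mdist a b < r -> c a (+) c b = phi a b.

(** Induction on the length in units of [r / 2]: past [w] the primitive continues as [phi w], the
    remaining points being within [r] of [w]. *)
Lemma exists_potential phi r x y : 0 < r -> cocycle setT r phi ->
  ((2 * mdist x y)%:E < systole G)%E -> exists c, potential r phi x y c.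
Proof.
move=> r0 phir.
suff H n : forall y, ((2 * mdist x y)%:E < systole G)%E -> mdist x y <= n%:R * (r / 2) ->
    exists c, potential r phi x y c.
  move=> sys; apply: (H (Num.bound (mdist x y / (r / 2)))) => //.
  rewrite -ler_pdivrMr ?divr_gt0// ltW// archi_boundP// divr_ge0 ?mdist_ge0//.
  by rewrite divr_ge0// ltW.
elim: n => [|n ih] {}y sys; rewrite ?mul0r => xy.
  have E a : between x a y -> a = x.
    move=> /between_le xa; apply/esym/mdist_positivity/eqP.
    by rewrite eq_le mdist_ge0 (le_trans xa).
  exists (fun=> false) => a b /E -> /E -> _.
  by rewrite (cocyclexx r0 phir).
have nr0 : 0 <= n%:R * (r / 2) by rewrite mulr_ge0// divr_ge0// ltW.
move: xy; rewrite -natr1 mulrDl mul1r => xy.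
have [xy'|yx'] := leP (mdist x y) (n%:R * (r / 2)); first exact: ih.
have [|w xw xwy] := @gG x y (n%:R * (r / 2)); first by rewrite nr0 ltW.
have [||c hc] := ih w; [|by rewrite xw|].
  by apply: le_lt_trans sys; rewrite lee_fin ler_pM2l// xw ltW.
exists (fun z => if mdist x z <= mdist x w then c z else c w (+) phi w z).
have close b : between x b y -> mdist x w < mdist x b -> mdist w b < r.
  move=> xby /ltW wb; have := between_linear sys xwy xby wb.
  by rewrite /between; have := between_le xby; rewrite xw; lra.
have mixed a b : between x a y -> between x b y -> mdist a b < r ->
    mdist x a <= mdist x w -> mdist x w < mdist x b ->
    c a (+) (c w (+) phi w b) = phi a b.
  move=> xay xby ab aw wb; have wbr := close _ xby wb.
  have xaw := between_linear sys xay xwy aw.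
  have xwb := between_linear sys xwy xby (ltW wb).
  have awr : mdist a w < r.
    apply: le_lt_trans ab.
    have := between_linear sys xay xby (le_trans aw (ltW wb)).
    by move: xaw xwb (mdist_ge0 w b); rewrite /between; lra.
  by rewrite addbA (hc a w)//; [exact: phir|exact: between_end].
move=> a b xay xby ab.
case: leP => aw; case: leP => bw.
- by apply: hc => //; apply: (between_linear sys).
- exact: mixed.
- by rewrite (cocycle_sym (x := a) (y := b) phir)// addbC mixed// metric_sym.
- rewrite -(cocycle_cone (x := w) (a := a) (b := b) phir)//; try exact: close.
  by case: (c w) (phi w a) (phi w b) => [] [] [].
Qed.

(** [psi x y] is the increment of a potential from [x] to [y]. It is independent of the potential,
    two of which differ by a locally constant function, and additive at intermediate points. A
    triangle with sides below [s] has perimeter below the systole, so a median splits it into three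
    legs, each counted twice. *)
Lemma extend_cocycle phi r s : 0 < r -> r <= s -> ((3 * s)%:E <= systole G)%E ->
  cocycle setT r phi ->
  exists2 psi, cocycle setT s psi & forall x y, mdist x y < r -> psi x y = phi x y.
Proof.
move=> r0 rs sys phir; have s0 := lt_le_trans r0 rs.
have sys2 x y : mdist x y < s -> ((2 * mdist x y)%:E < systole G)%E.
  by move=> xy; apply: lt_le_trans sys; rewrite lte_fin; lra.
have [Psi hPsi] : {Psi : G * G -> bool & forall p, mdist p.1 p.2 < s ->
    exists2 c, potential r phi p.1 p.2 c & Psi p = c p.1 (+) c p.2}.
  apply: (@choice _ _ (fun p v => mdist p.1 p.2 < s -> 
    exists2 c, potential r phi p.1 p.2 c & v = c p.1 (+) c p.2)) => -[x y] /=.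
  have [xy|] := boolP (mdist x y < s); last by exists false.
  have [c hc] := exists_potential r0 phir (sys2 _ _ xy).
  by exists (c x (+) c y) => _; exists c.
pose psi x y := Psi (x, y).
have psiE x y c : mdist x y < s -> potential r phi x y c -> psi x y = c x (+) c y.
  move=> xy hc; have [c' hc' e] := hPsi (x, y) xy; rewrite /psi e /=.
  have : c x (+) c' x = c y (+) c' y.
    apply: (between_locally_constant gG (c := fun z => c z (+) c' z) r0) => a b ha hb ab.
    have := hc _ _ ha hb ab; rewrite -(hc' _ _ ha hb ab).
    by case: (c a) (c b) (c' a) (c' b) => [] [] [] [].
  by case: (c x) (c y) (c' x) (c' y) => [] [] [] [].
have psi_sym x y : mdist x y < s -> psi x y = psi y x.
  move=> xy; have [c hc _] := hPsi (x, y) xy.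
  have hc' : potential r phi y x c.
    by move=> a b ha hb ab; apply: hc => //; apply: between_sym.
  have yx : mdist y x < s by rewrite metric_sym.
  by rewrite (psiE _ _ _ xy hc) (psiE _ _ _ yx hc') addbC.
have psi_split x w y : mdist x y < s -> between x w y -> psi x y = psi x w (+) psi w y.
  move=> xy xwy; have [c hc _] := hPsi (x, y) xy.
  have xw := between_le xwy; have := between_le (between_sym xwy).
  rewrite (metric_sym y w) (metric_sym y x) => wy.
  have hwy : potential r phi w y c.
    move=> a b ha hb ab; apply: hc => //.
      by apply/between_sym/(between_trans (between_sym xwy) (between_sym ha)).1.
    by apply/between_sym/(between_trans (between_sym xwy) (between_sym hb)).1.
  have hxw : potential r phi x w c.
    move=> a b ha hb ab; apply: hc => //; first exact: (between_trans xwy ha).1.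
    exact: (between_trans xwy hb).1.
  rewrite (psiE _ _ _ xy hc) (psiE _ _ _ (le_lt_trans xw xy) hxw).
  rewrite (psiE _ _ _ (le_lt_trans wy xy) hwy).
  by case: (c x) (c w) (c y) => [] [] [].
exists psi.
  move=> x y z _ _ _ xy yz xz.
  have [|w [xwy ywz xwz]] := @triangle_median _ _ cG gG x y z.
    by apply: lt_le_trans sys; rewrite lte_fin; lra.
  rewrite (psi_split x w y)// (psi_split y w z)// (psi_split x w z)//.
  rewrite (psi_sym w y); last first.
    apply: le_lt_trans xy; rewrite (metric_sym w) (metric_sym x).
    exact/between_le/between_sym.
  by rewrite addbA -(addbA (psi x w)) addbb addbF.
(* For [mdist x y < r], the function [phi x] is itself a potential. *)
move=> x y xy; rewrite (psiE x y (phi x)).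
- by rewrite (cocyclexx r0 phir).
- exact: lt_le_trans rs.
- move=> a b /between_le xa /between_le xb ab; apply: (cocycle_cone phir) => //.
    exact: le_lt_trans xy.
  exact: le_lt_trans xy.
Qed.

(** The same primitive works at both scales, since [phi x z (+) psi x z (+) c z] is locally constant
    in [z] between [x] and [y]. *)
Lemma cohomologous_scale phi psi r s : 0 < r -> 
  cocycle setT s phi -> cocycle setT s psi ->
  cohomologous setT r phi psi -> cohomologous setT s phi psi.
Proof.
move=> r0 hphi hpsi [c hc]; exists c => x y _ _ xy.
have s0 : 0 < s by rewrite (le_lt_trans (mdist_ge0 x y)).
have rs0 : 0 < Num.min r s by rewrite lt_min r0.
have := @between_locally_constant _ _ gG _
  (fun z => phi x z (+) psi x z (+) c z) _ x y rs0.
rewrite (cocyclexx s0 hphi)// (cocyclexx s0 hpsi)//.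
move=> H; suff : c x = phi x y (+) psi x y (+) c y.
  by move=> ->; case: (phi x y) (psi x y) (c y) => [] [] [].
apply: H => a b /between_le xa /between_le xb; rewrite lt_min => /andP[ab ab'].
have cone chi : cocycle setT s chi -> chi x a (+) chi x b = chi a b.
  by move=> hchi; apply: (cocycle_cone hchi) => //; apply: le_lt_trans xy.
have := hc a b I I ab; rewrite -(cone _ hphi) -(cone _ hpsi).
by case: (phi x a) (phi x b) (psi x a) (psi x b) (c a) (c b) => [] [] [] [] [] [].
Qed.

(* A cocycle is determined up to coboundaries by its values on a finite net. *)
Lemma pigeonhole_cocycles s (S : nat -> G -> G -> bool) : 0 < s ->
  (forall n, cocycle setT s (S n)) ->
  exists m n, (m < n)%N /\ cohomologous setT (s / 2) (S m) (S n).
Proof.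
move=> s0 hS; have s40 : 0 < s / 4 by rewrite divr_gt0.
have [net hnet] := @compact_finite_subcover _ _ (fun=> s / 4) cG (fun=> s40).
have [k hk] : {k : G -> 'I_(size net) & forall x, mdist (tnth (in_tuple net) (k x)) x < s / 4}.
  apply: (@choice _ _ (fun x i => mdist (tnth (in_tuple net) i) x < s / 4)) => x.
  have [c cn cx] := hnet x; have ci : (index c net < size net)%N by rewrite index_mem.
  by exists (Ordinal ci); rewrite (tnth_nth c)/= nth_index.
pose K x := tnth (in_tuple net) (k x).
pose F n : {ffun 'I_(size net) * 'I_(size net) -> bool} :=
  [ffun p => S n (tnth (in_tuple net) p.1) (tnth (in_tuple net) p.2)].
have [m [n [mn Fmn]]] : exists m n, (m < n)%N /\ F m = F n.
  apply: contrapT => ninj.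
  have Finj : injective F.
    move=> m n e; case: (ltngtP m n) => // lt; case: ninj; [exists m, n|exists n, m] => //.
  pose M := #|{ffun 'I_(size net) * 'I_(size net) -> bool}|.
  have := @leq_card _ _ (fun i : 'I_M.+1 => F i).
  by rewrite card_ord ltnn => H; have : false by apply: H => i j /Finj/val_inj.
(* The path [K x], [x], [y], [K y] has length below [s / 4 + s / 2 + s / 4 = s]. Its middle edge is
   compared with the net through the two outer edges, which give the primitive. *)
exists m, n; split=> //; exists (fun x => S m x (K x) (+) S n x (K x)) => x y _ _ xy.
have Kx z : mdist z (K z) < s / 4 by rewrite metric_sym; exact: hk.
have xKy : mdist x (K y) < s.
  by have := metric_triangle x y (K y); have := Kx y; lra.
have KK : mdist (K x) (K y) < s.
  have := metric_triangle (K x) x (K y); have := metric_triangle x y (K y).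
  by rewrite (metric_sym (K x) x); have := Kx y; have := Kx x; lra.
have E l : S l x y = S l (K x) (K y) (+) (S l x (K x) (+) S l y (K y)).
  by apply: (cocycle_path4 (hS l)) => //; have := Kx x; have := Kx y; lra.
rewrite (E m) (E n); have := congr1 (fun f : {ffun _ -> _} => f (k x, k y)) Fmn.
rewrite !ffunE /= -!/(K _) => ->.
by case: (S n (K x) _) (S m x _) (S m y _) (S n x _) (S n y _) => [] [] [] [] [].
Qed.

(* Covering dimension at most one: the nerve of the cells of [i] has no triangles. *)
Definition one_dimensional := forall r, 0 < r ->
  exists (T : Type) (i : G -> T) (e : R), [/\ 0 < e,
    forall x y, i x = i y -> mdist x y < r &
    forall x y z, mdist x y < e -> mdist y z < e -> mdist x z < e ->
      [\/ i x = i y, i y = i z | i x = i z]].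

(* As no three distinct cells are close to each other, the cocycle condition is
   void for functions of the cells: pairs of cells that miss [N] get value 0. *)
Lemma extend_from_subset (N : set G) r psi : one_dimensional -> 0 < r -> cocycle N r psi ->
  exists phi e, [/\ 0 < e, cocycle setT e phi & cohomologous N e psi phi].
Proof.
move=> dim1 r0 hpsi; have r30 : 0 < r / 3 by rewrite divr_gt0.
have [T [i [e [e0 mesh nerve]]]] := dim1 _ r30.
have [B hB] : {B : T -> option G & forall t,
    if B t is Some b then N b /\ i b = t else forall x, N x -> i x <> t}.
  apply: (@choice _ _ (fun t o => if o is Some b then N b /\ i b = t
    else forall x, N x -> i x <> t)) => t.
  have [[b [Nb bt]]|nb] := pselect (exists b, N b /\ i b = t); first by exists (Some b).
  by exists None => x Nx xt; apply: nb; exists x.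
(* [e] serves the nerve condition; [r / 3] keeps the representatives of the cells of two close
   points of [N] within [r]. *)
pose d := Num.min e (r / 3).
pose phi x y := if B (i x) is Some a then
  if B (i y) is Some b then `[< mdist a b < r >] && psi a b else false else false.
have d0 : 0 < d by rewrite /d lt_min e0.
have phi_eq x y : i x = i y -> phi x y = false.
  rewrite /phi => <-; case: (B (i x)) (hB (i x)) => // b [Nb _].
  by case: asboolP => // _; apply: cocyclexx r0 hpsi Nb.
have phi_sym x y : phi x y = phi y x.
  rewrite /phi; case: (B (i x)) (hB (i x)) => [a [Na _]|_];
    case: (B (i y)) (hB (i y)) => [b [Nb _]|_] //.
  rewrite (metric_sym b a); case: asboolP => // ab; exact: cocycle_sym hpsi _ _ ab.
exists phi, d; split => //.
- move=> x y z _ _ _; rewrite !lt_min => /andP[xy _] /andP[yz _] /andP[xz _].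
  have [e1|e1|e1] := nerve _ _ _ xy yz xz.
  + by rewrite (phi_eq x y)// /phi e1.
  + by rewrite (phi_eq y z)// addbF /phi e1.
  + by rewrite (phi_eq x z)// (phi_sym y z) /phi e1 addbb.
(* The primitive is the value of [psi] from a point to the representative of its cell; the default
   [x] does not occur on [N]. *)
pose b0 x := odflt x (B (i x)).
exists (fun x => psi x (b0 x)) => x y Nx Ny; rewrite lt_min => /andP[_ xy].
have hb0 z : N z -> [/\ B (i z) = Some (b0 z), N (b0 z) & mdist z (b0 z) < r / 3].
  move=> Nz; rewrite /b0; case: (B (i z)) (hB (i z)) => [b [Nb bz]|/(_ z Nz)//].
  by split=> //; apply: mesh.
have [Bx Nbx xbx] := hb0 x Nx; have [By Nby yby] := hb0 y Ny.
have xby : mdist x (b0 y) < r by have := metric_triangle x y (b0 y); lra.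
have bb : mdist (b0 x) (b0 y) < r.
  have := metric_triangle (b0 x) x (b0 y); have := metric_triangle x y (b0 y).
  by rewrite (metric_sym (b0 x) x); lra.
have -> : phi x y = psi (b0 x) (b0 y) by rewrite /phi Bx By asboolT.
by apply: (cocycle_path4 hpsi) => //; lra.
Qed.

End scales.

(** * Local structure of a metric graph *)

Section local_structure.
Context {R : realType} {G : metricType R}.
Implicit Types (x y z p q : G) (r s t e : R).

Lemma star_chart p n : has_degree p n -> exists (r : R) (f : star n r -> G) (rho : R),
  [/\ 0 < r, 0 < rho, f (tip n r) = p,
      forall P Q, mdist (f P) (f Q) = star_dist P Q &
      forall y, mdist p y < rho -> exists P, y = f P].
Proof.
move=> [r [V [f [r0 Vp [fi fV] fp]]]].
have [rho /= rho0 hrho] := (nbhs_ballP _ _).1 Vp.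
exists r, f, rho; split=> //.
  by move=> P Q; rewrite fi ?in_setT.
move=> y py; have : V y by apply: hrho; rewrite ballEmdist.
by rewrite -fV => -[P _ <-]; exists P.
Qed.

(** Inside the chart a sphere about [p] has one point on each arm. *)
Lemma finite_sphere p n r : has_degree p n -> 0 < r ->
  exists t (s : seq G), 0 < t < r /\ forall q, mdist p q = t -> q \in s.
Proof.
move=> /star_chart[r0 [f [rho [r00 rho0 fp fi frho]]]] rp.
pose m := Num.min r (Num.min r0 rho); pose t := m / 2.
have m0 : 0 < m by rewrite !lt_min rp r00.
have /and3P[mr mr0 mrho] : [&& m <= r, m <= r0 & m <= rho].
  by rewrite !ge_min !lexx !orbT.
have t0 : 0 < t <= r0 by rewrite /t; apply/andP; split; lra.
exists t, [seq f (Some (i, exist _ t t0)) | i <- enum 'I_n]; split.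
  by rewrite /t; apply/andP; split; lra.
move=> q pq; have [|P qP] := frho q; first by rewrite pq /t; lra.
subst q; move: pq; rewrite -fp fi; case: P => [[i u]|] /= ut; last first.
  by exfalso; case/andP: t0; rewrite -ut ltxx.
apply/mapP; exists i; first by rewrite mem_enum.
by congr (f (Some (i, _))); apply: val_inj.
Qed.

(** A star without arms is only its tip, whereas a geodesic to another point would meet the chart
    away from [p]. *)
Lemma degree0_trivial p q : geodesic_space G -> has_degree p 0 -> q = p.
Proof.
move=> gG /star_chart[r0 [f [rho [r00 rho0 fp fi frho]]]].
apply: contrapT => qp.
have pq : 0 < mdist p q by rewrite mdist_gt0; apply/eqP => e; apply: qp.
pose m := Num.min (mdist p q) (rho / 2).
have m0 : 0 < m by rewrite lt_min pq divr_gt0.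
have [|z pz _] := gG p q m; first by rewrite ltW//= ge_min lexx.
have mrho : m <= rho / 2 by rewrite ge_min lexx orbT.
have [|P zP] := frho z; first by rewrite pz; lra.
have : z = p by rewrite zP -fp; case: P {zP} => [[[]]|].
by move=> zp; move: m0; rewrite -pz zp mdistxx ltxx.
Qed.

(* The class dual to crossing [p] through one of its arms. *)
Lemma local_class p n rho : has_degree p n.+2 -> 0 < rho ->
  exists (theta : G -> G -> bool) (e : R), [/\ 0 < e, cocycle setT e theta,
    forall x y, theta x y -> mdist p x < rho /\ mdist x y = mdist p x + mdist p y &
    forall eta, 0 < eta -> exists y1 y2, [/\ 0 < mdist p y1 < eta,
      0 < mdist p y2 < eta, theta y1 p & ~~ theta y2 p]].
Proof.
move=> /star_chart[r0 [f [rho' [r00 rho'0 fp fi frho]]]] rhop.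
pose m := Num.min rho rho'.
have m0 : 0 < m by rewrite lt_min rhop.
have mrho : m <= rho by rewrite ge_min lexx.
have mrho' : m <= rho' by rewrite ge_min lexx orbT.
clearbody m.
have finj P Q : f P = f Q -> P = Q.
  by move=> e; apply: mdist_positivity; rewrite /mdist /= -fi e mdistxx.
(* Marks one arm without its tip; [theta] marks the pairs near [p] with exactly one point on that
   arm. *)
pose kappa y := `[< exists u, y = f (Some (ord0, u)) >].
have kappaE x y : mdist p x < m -> mdist p y < m -> kappa x -> ~~ kappa y ->
    mdist x y = mdist p x + mdist p y.
  move=> px py /asboolP[u ->] /asboolPn ky.
  have [Q yQ] := frho y (lt_le_trans py mrho'); subst y.
  rewrite -fp !fi; case: Q py ky => [[j v]|] py ky /=; last by rewrite addr0.
  by case: eqP => // e; case: ky; exists v; rewrite e.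
pose theta x y := [&& mdist p x < m, mdist p y < m & kappa x (+) kappa y].
have thetaE x y : theta x y -> mdist x y = mdist p x + mdist p y.
  move=> /and3P[px py]; case kx : (kappa x); case ky : (kappa y) => //= _.
    by apply: kappaE; rewrite ?kx ?ky.
  by rewrite metric_sym addrC; apply: kappaE; rewrite ?kx ?ky.
exists theta, (m / 4); split.
- by rewrite divr_gt0.
- move=> x y z _ _ _ xy yz xz.
  (* A marked pair is as far apart as the sum of its distances to [p]; hence cutting off at radius
     [m] spoils no small triangle. *)
  have far a b : m / 2 <= mdist p a -> m / 2 <= mdist p b -> mdist a b < m / 4 ->
      theta a b = false.
    by move=> pa pb ab; apply/negP => /thetaE; lra.
  have [hx|hx] := leP m (mdist p x).
    have := metric_triangle p y x; have := metric_triangle p z x.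
    by rewrite (metric_sym y x) (metric_sym z x) => ? ?; rewrite !far//; lra.
  have [hy|hy] := leP m (mdist p y).
    have := metric_triangle p x y; have := metric_triangle p z y.
    by rewrite (metric_sym z y) => ? ?; rewrite !far//; lra.
  have [hz|hz] := leP m (mdist p z).
    have := metric_triangle p x z; have := metric_triangle p y z.
    by move=> ? ?; rewrite !far//; lra.
  by rewrite /theta hx hy hz /=; case: (kappa x) (kappa y) (kappa z) => [] [] [].
- move=> x y xy; split; last exact: thetaE.
  by case/and3P: xy => px _ _; apply: lt_le_trans mrho.
- move=> eta eta0; pose t := Num.min (Num.min eta m) r0 / 2.
  have t0 : 0 < t by rewrite divr_gt0// !lt_min eta0 m0.
  have /and3P[t1 t2 t3] : [&& t < eta, t < m & t <= r0].
    have : [&& t * 2 <= eta, t * 2 <= m & t * 2 <= r0].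
      by rewrite /t divfK ?pnatr_eq0// !ge_min !lexx !orbT.
    by case/and3P => ? ? ?; apply/and3P; split; lra.
  have tr : 0 < t <= r0 by rewrite t0.
  pose pt i : G := f (Some (i, exist _ t tr)).
  have dpt i : mdist p (pt i) = t by rewrite -fp fi.
  have kp : kappa p = false.
    by apply/asboolPn => -[u]; rewrite -fp => /finj.
  exists (pt ord0), (pt ord_max); rewrite !dpt t0 t1 /theta !dpt mdistxx t2 m0 kp /=.
  split=> //; rewrite addbF.
    by apply/asboolP; exists (exist _ t tr).
  by apply/asboolPn => -[u /finj] [].
Qed.

(** Nonpositive entries are skipped because the mutual distances of a list of points include
    zeros. *)
Lemma positive_lower_bound (l : seq R) : exists2 e, 0 < e &
  forall t, t \in l -> 0 < t -> e <= t.
Proof.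
elim: l => [|u l [e e0 ih]]; first by exists 1.
have [u0|u0] := leP u 0; last first.
  exists (Num.min e u) => [|t]; first by rewrite lt_min e0.
  rewrite inE => /orP[/eqP-> _|tl t0]; first by rewrite ge_min lexx orbT.
  by rewrite ge_min ih.
exists e => // t; rewrite inE => /orP[/eqP->|]; last exact: ih.
by rewrite ltNge u0.
Qed.

(* Small spheres are finite sets; removing neighbourhoods of the points of
   finitely many of them cuts [G] into small pieces. *)
Lemma graph_one_dimensional : compact [set: G] -> geodesic_space G ->
  (forall x : G, exists n, has_degree x n) -> one_dimensional (G := G).
Proof.
move=> cG gG deg r r0; have r20 : 0 < r / 2 by rewrite divr_gt0.
have [ts hts] : {ts : G -> R * seq G & forall x, 0 < (ts x).1 < r / 2 /\
    forall q, mdist x q = (ts x).1 -> q \in (ts x).2}.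
  apply: (@choice _ _ (fun x (ts : R * seq G) => 0 < ts.1 < r / 2 /\
    forall q, mdist x q = ts.1 -> q \in ts.2)) => x.
  have [n xn] := deg x; have [t [s hs]] := finite_sphere xn r20.
  by exists (t, s).
have ts0 x : 0 < (ts x).1 by have [/andP[]] := hts x.
have [net hnet] := compact_finite_subcover cG ts0.
pose S := flatten [seq (ts c).2 | c <- net].
have [sep sep0 hsep] := positive_lower_bound [seq mdist q q' | q <- S, q' <- S].
pose e := Num.min (sep / 4) (r / 2).
have e0 : 0 < e by rewrite lt_min r20 divr_gt0.
have esep : e <= sep / 4 by rewrite ge_min lexx.
have er : e <= r / 2 by rewrite ge_min lexx orbT.
pose near x q := mdist q x < e.
(* A cell gathers the points close to a given sphere point, or, away from these, the points lying in
   the same balls of the net. *)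
pose i x : G + seq G := if has (near x) S then inl (nth x S (find (near x) S))
  else inr [seq c <- net | mdist c x < (ts c).1].
have iE x : has (near x) S -> exists q, [/\ i x = inl q, q \in S & mdist q x < e].
  move=> hx; exists (nth x S (find (near x) S)); rewrite /i hx; split=> //.
    by rewrite mem_nth// -has_find.
  exact: (nth_find x hx).
have i_near x y : has (near x) S -> has (near y) S -> mdist x y < e -> i x = i y.
  move=> /iE[q [-> qS qx]] /iE[q' [-> q'S q'y]] xy; congr inl.
  apply/mdist_positivity/eqP; rewrite eq_le mdist_ge0 andbT leNgt; apply/negP => qq'.
  have : sep <= mdist q q' by apply: hsep => //; apply: allpairs_f.
  have := metric_triangle q x q'; have := metric_triangle x y q'.
  by rewrite (metric_sym y q'); lra.
(* A short move that leaves a ball crosses its sphere, and therefore starts near a point of [S]. *)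
have cross x y c : ~~ has (near x) S -> mdist x y < e -> c \in net ->
    mdist c x < (ts c).1 -> mdist c y < (ts c).1.
  move=> /hasPn hx xy cn cx; rewrite ltNge; apply/negP => cy.
  have [|q xqy cq] := between_value cG gG (mdist_abs_triangle c)
    (x := x) (y := y) (v := (ts c).1); first by rewrite ltW.
  have qS : q \in S.
    apply/flattenP; exists (ts c).2; last by have [_] := hts c; apply.
    exact: map_f.
  have := hx q qS; rewrite /near metric_sym; move/negP; apply.
  exact: le_lt_trans (between_le xqy) xy.
have i_far x y : ~~ has (near x) S -> ~~ has (near y) S -> mdist x y < e -> i x = i y.
  move=> hx hy xy; rewrite /i (negbTE hx) (negbTE hy); congr inr.
  apply: eq_in_filter => c cn; apply/idP/idP; first exact: cross.
  by apply: cross => //; rewrite metric_sym.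
exists (G + seq G)%type, i, e; split => //.
  move=> x y; case hx : (has (near x) S).
    have [q [-> _ qx]] := iE _ hx.
    case hy : (has (near y) S); last by rewrite /i hy.
    have [q' [-> _ q'y]] := iE _ hy => -[qq'].
    by have := metric_triangle x q y; rewrite (metric_sym x q) {2}qq'; lra.
  case hy : (has (near y) S); first by have [q [-> _ _]] := iE _ hy; rewrite /i hx.
  rewrite /i hx hy => -[fxy].
  have [c cn cx] := hnet x.
  have : c \in [seq c <- net | mdist c x < (ts c).1] by rewrite mem_filter cx.
  rewrite fxy mem_filter => /andP[cy _].
  have [/andP[_ tr] _] := hts c.
  by have := metric_triangle x c y; rewrite (metric_sym x c); lra.
move=> x y z xy yz xz.
(* Two of the three points are both near [S] or both away from it. *)
case hx : (has (near x) S); case hy : (has (near y) S); case hz : (has (near z) S).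
all: try by apply: Or31; apply: i_near.
all: try by apply: Or32; apply: i_near.
all: try by apply: Or33; apply: i_near.
all: try by apply: Or31; apply: i_far; rewrite ?hx ?hy.
all: try by apply: Or32; apply: i_far; rewrite ?hy ?hz.
all: by apply: Or33; apply: i_far; rewrite ?hx ?hz.
Qed.

End local_structure.

(** * Pulling back along a near isometry *)

Lemma addb_balance (p p' q q' c c' u v : bool) :
  p (+) p' = u -> q (+) q' = v -> v = u (+) (c (+) c') ->
  p (+) c (+) q = p' (+) c' (+) q'.
Proof. by case: p p' q q' c c' u v => [] [] [] [] [] [] [] []. Qed.

Lemma addb_transfer (a b u v m s t : bool) :
  a (+) (u (+) m) (+) (b (+) (v (+) m)) =
  u (+) v (+) (s (+) t) (+) (a (+) s (+) (b (+) t)).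
Proof. by case: a b u v m s t => [] [] [] [] [] [] []. Qed.

(** The estimates given by a correspondence of distortion below [2 * delta]; [g] is constrained on
    [U] only. *)
Record near_isometry {R : realType} {G : metricType R} (U : set G)
    (f g : G -> G) (delta : R) : Prop := NearIsometry {
  near_image : forall x, U (f x) ;
  near_lt : forall x y, mdist (f x) (f y) < mdist x y + 2 * delta ;
  near_inv_lt : forall u v, U u -> U v -> mdist (g u) (g v) < mdist u v + 2 * delta ;
  near_inv_left : forall x, mdist x (g (f x)) < 2 * delta ;
  near_inv_right : forall u, U u -> mdist u (f (g u)) < 2 * delta }.

Section correspondence.
Context {R : realType} {G : metricType R}.
Hypotheses (cG : compact [set: G]) (gG : geodesic_space G).
Hypothesis dim1 : one_dimensional (G := G).
Variables (U : set G) (f g : G -> G).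
Implicit Types (delta tau r : R) (phi psi theta : G -> G -> bool).

Local Notation pull phi := (fun x y => phi (f x) (f y)).

(** Pairs closer than [tau] go to pairs closer than [tau + 2 * delta], where a primitive at scale
    [r] still works by [cohomologous_scale]. *)
Lemma cohomologous_pull delta tau r phi psi : 0 < delta -> near_isometry U f g delta ->
  0 < r -> cocycle setT (4 * delta + tau) phi -> cocycle setT (4 * delta + tau) psi ->
  cohomologous setT r phi psi -> cohomologous setT tau (pull phi) (pull psi).
Proof.
move=> delta0 [fU f_lt _ _ _] r0 hphi hpsi /(cohomologous_scale gG r0 hphi hpsi)[c hc].
exists (c \o f) => x y _ _ xy; apply: hc => //.
by have := f_lt x y; lra.
Qed.

(* Surjectivity of the pullback along [f]: transport [theta] to [U] by [g],
   thicken [U] to its [delta]-neighbourhood, where geodesics between points of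
   [U] at distance about [2 delta] run, and extend from there to [G]. *)
Lemma pull_surjective delta tau theta : 0 < delta -> 0 < tau ->
  near_isometry U f g delta -> ((3 * (4 * delta + tau))%:E <= systole G)%E ->
  cocycle setT (4 * delta + tau) theta ->
  exists theta' e, [/\ 0 < e, cocycle setT (4 * delta + tau) theta' &
    cohomologous setT e (pull theta') theta].
Proof.
move=> delta0 tau0 [fU f_lt g_lt gf_lt fg_lt] sys htheta.
have scale0 : 0 < 4 * delta + tau by lra.
 pose N := [set x | exists2 u, U u & mdist x u < delta + tau / 4].
have [k hk] : {k : G -> G & forall x, N x -> U (k x) /\ mdist x (k x) < delta + tau / 4}.
  apply: (@choice _ _ (fun x u => N x -> U u /\ mdist x u < delta + tau / 4)) => x.
  by have [[u Uu xu]|nN] := pselect (N x); [exists u|exists x].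
pose om x y := theta (g (k x)) (g (k y)).
(* Moving both points to [U] costs [2 * (delta + tau / 4)] and applying [g] costs [2 * delta], which
   turns [tau / 2] into the full scale. *)
have kk x y : N x -> N y -> mdist x y < tau / 2 -> mdist (g (k x)) (g (k y)) < 4 * delta + tau.
  move=> /hk[Ux xkx] /hk[Uy yky] xy; have := g_lt _ _ Ux Uy.
  have := metric_triangle (k x) x (k y); have := metric_triangle x y (k y).
  by rewrite (metric_sym (k x) x); lra.
have hom : cocycle N (tau / 2) om.
  by move=> x y z Nx Ny Nz xy yz xz; apply: htheta => //; exact: kk.
have tau20 : 0 < tau / 2 by rewrite divr_gt0.
have [phi [e1 [e10 hphi [c hc]]]] := extend_from_subset dim1 tau20 hom.
pose e := Num.min e1 (tau / 4).
have e0 : 0 < e by rewrite lt_min e10 divr_gt0.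
have ee1 : e <= e1 by rewrite ge_min lexx.
have etau : e <= tau / 4 by rewrite ge_min lexx orbT.
clearbody e.
have hphie : cocycle setT e phi.
  by move=> x y z _ _ _ xy yz xz; apply: hphi => //; exact: lt_le_trans ee1.
have [|theta' htheta' theta'E] := extend_cocycle cG gG e0 _ sys hphie; first by lra.
exists theta', e; split=> //.
pose C z := c z (+) theta (g z) (g (k z)).
(* Geodesics between points of [U] closer than [2 * delta + e] are cut at the midpoint: each half
   stays within [delta + e / 2] of its end, hence in [N], where [phi] is [om] up to the coboundary
   of [c]. *)
have half a m : U a -> mdist a m < delta + e / 2 ->
    mdist (g a) (g (k m)) < 4 * delta + tau /\
    theta' a m = C a (+) (theta (g a) (g (k m)) (+) c m).
  move=> Ua am.
  have bN z : between a z m -> N z.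
    by move=> /between_le az; exists a => //; rewrite metric_sym; lra.
  have ak z : between a z m -> mdist (g a) (g (k z)) < 4 * delta + tau.
    move=> azm; have [Ukz zkz] := hk z (bN z azm).
    have := g_lt _ _ Ua Ukz; have := metric_triangle a z (k z).
    by have := between_le azm; lra.
  split; first exact/ak/between_end.
  have : theta' a a (+) c a (+) theta (g a) (g (k a)) =
         theta' a m (+) c m (+) theta (g a) (g (k m)).
    apply: (between_locally_constant gG
      (c := fun z => theta' a z (+) c z (+) theta (g a) (g (k z))) e0) => z z' hz hz' zz'.
    have H1 : theta' a z (+) theta' a z' = phi z z'.
      rewrite -theta'E//; apply: (cocycle_cone htheta') => //.
      - by have := between_le hz; lra.
      - by have := between_le hz'; lra.
      - by lra.
    have H2 : theta (g a) (g (k z)) (+) theta (g a) (g (k z')) = om z z'.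
      by apply: (cocycle_cone htheta) => //; try exact: ak; apply: kk;
        [exact: bN|exact: bN|lra].
    have := hc z z' (bN z hz) (bN z' hz') (lt_le_trans zz' ee1).
    exact: addb_balance H1 H2.
  rewrite (cocyclexx scale0 htheta')// /C.
  by case: (theta' a m) (c a) (c m) (theta _ _) (theta _ _) => [] [] [] [] [].
(* [C] accounts for the passage to [U], the second term for the move from [x] to [g (f x)]. *)
exists (fun x => C (f x) (+) theta x (g (f x))) => x y _ _ xy.
have fxy := f_lt x y; have d0 := mdist_ge0 (f x) (f y).
have [|m xm] := @gG (f x) (f y) (mdist (f x) (f y) / 2).
  by apply/andP; split; lra.
rewrite /between xm => my.
have fxm : mdist (f x) m < delta + e / 2 by lra.
have fym : mdist (f y) m < delta + e / 2 by rewrite metric_sym; lra.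
have [gmx h1] := half _ _ (fU x) fxm.
have [gmy h2] := half _ _ (fU y) fym.
have gxy : mdist (g (f x)) (g (f y)) < 4 * delta + tau.
  by have := g_lt _ _ (fU x) (fU y); lra.
have E1 : theta' (f x) (f y) = theta' (f x) m (+) theta' (f y) m.
  rewrite -(htheta' (f x) m (f y))//; try lra.
  by rewrite (cocycle_sym htheta' (x := m))//; lra.
have E2 : theta (g (f x)) (g (k m)) (+) theta (g (f y)) (g (k m)) =
    theta (g (f x)) (g (f y)).
  rewrite (cocycle_sym htheta (x := g (f y)))//; apply: htheta => //.
  by rewrite metric_sym.
have E3 : theta x y = theta (g (f x)) (g (f y)) (+)
    (theta x (g (f x)) (+) theta y (g (f y))).
  apply: (cocycle_path4 htheta) => //.
  - by have := gf_lt x; lra.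
  - by have := gf_lt y; lra.
  - by have := metric_triangle x y (g (f y)); have := gf_lt y; lra.
  - by lra.
rewrite E1 h1 h2 E3 -E2.
exact: addb_transfer.
Qed.

(* Off [p], both arms at [p] are joined to [U] by geodesics, and points of [U]
   are joined to one another through [f]; so a primitive of [theta] could not
   separate the arms. *)
Lemma local_class_nontrivial delta tau (h : R) p theta eta :
  0 < delta -> 0 < tau -> near_isometry U f g delta -> delta + tau < h ->
  (forall u, U u -> h <= mdist p u) ->
  (forall y e, 0 < e -> exists2 u, U u & mdist y u < h + e) ->
  0 < eta ->
  (forall x y, theta x y -> mdist x y = mdist p x + mdist p y) ->
  (forall e, 0 < e -> exists y1 y2, [/\ 0 < mdist p y1 < e,
      0 < mdist p y2 < e, theta y1 p & ~~ theta y2 p]) ->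
  ~ cohomologous setT eta theta (fun _ _ => false).
Proof.
move=> delta0 tau0 [fU f_lt g_lt gf_lt fg_lt] dth pU nearU eta0 thetaE arms [c hc].
(* [c] changes only across pairs marked by [theta], and a marked pair staying [sg] away from [p] has
   distance at least [2 * sg]. *)
have avoid a b sg : 0 < sg -> (forall z, between a z b -> sg <= mdist p z) -> c a = c b.
  move=> sg0 hsg; have e0 : 0 < Num.min eta sg by rewrite lt_min eta0.
  apply: (between_locally_constant gG e0) => x y hx hy; rewrite lt_min => /andP[xy xy'].
  have := hc x y I I xy; case txy : (theta x y).
    by have := thetaE _ _ txy; have := hsg _ hx; have := hsg _ hy; lra.
  by case: (c x) (c y) => [] [].
(* Every point of the geodesic is within [delta + tau / 2] of [u] or [v], which are at least [h]
   away from [p]. *)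
have constU u v : U u -> U v -> mdist u v < 2 * delta + tau -> c u = c v.
  move=> Uu Uv uv; apply: (@avoid u v (h - delta - tau / 2)); first by lra.
  move=> z; rewrite /between => uzv; have := pU u Uu; have := pU v Uv.
  have := metric_triangle p z u; have := metric_triangle p z v.
  by rewrite (metric_sym z u); lra.
have constf x y : c (f x) = c (f y).
  apply: (between_locally_constant gG tau0 (c := c \o f)) => a b _ _ ab /=.
  by apply: constU => //; have := f_lt a b; lra.
have const u v : U u -> U v -> c u = c v.
  move=> Uu Uv; rewrite (constU u (f (g u)))//; last by have := fg_lt u Uu; lra.
  rewrite (constf _ (g v)) -(constU v (f (g v)))//.
  by have := fg_lt v Uv; lra.
(* With [u] closer to [y] than [h + mdist p y], no geodesic from [y] to [u] passes through [p]; half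
   the slack bounds its distance from [p]. *)
have arm y : 0 < mdist p y -> exists2 u, U u & c y = c u.
  move=> py; have [u Uu yu] := nearU y _ py; exists u => //.
  have := pU u Uu => pu.
  apply: (@avoid y u ((mdist p y + h - mdist y u) / 2)); first by lra.
  move=> z; rewrite /between => yzu; have := metric_triangle p z y.
  by have := metric_triangle p z u; rewrite (metric_sym z y); lra.
have [y1 [y2 [/andP[py1 y1e] /andP[py2 y2e] t1 t2]]] := arms _ eta0.
have [u1 U1 e1] := arm _ py1; have [u2 U2 e2] := arm _ py2.
rewrite metric_sym in y1e; rewrite metric_sym in y2e.
have := hc y1 p I I y1e; have := hc y2 p I I y2e.
by rewrite t1 (negbTE t2) e1 e2 (const _ _ U1 U2); case: (c u2) (c p) => [] [].
Qed.

(** Finiteness enters through a sequence [S] starting with zero and the class at [p], each term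
    cohomologous at some scale to the pullback of the next. A repetition among the classes descends
    to the first two terms. *)
Lemma near_isometry_dist_ge delta (h : R) p N : 0 < delta -> near_isometry U f g delta ->
  ((12 * delta)%:E < systole G)%E -> has_degree p N.+2 ->
  (forall u, U u -> h <= mdist p u) ->
  (forall y e, 0 < e -> exists2 u, U u & mdist y u < h + e) ->
  h <= delta.
Proof.
move=> delta0 hfg sys degp pU nearU; rewrite leNgt; apply/negP => dh.
(* [tau] is taken from the slack in [delta < h] and, if the systole is finite, from that in
   [12 * delta < systole G]. *)
have [tau [tau0 dth sys']] : exists tau, [/\ 0 < tau, delta + tau < h &
    ((3 * (4 * delta + tau))%:E <= systole G)%E].
  case: (systole G) sys => [s||]//.
  - rewrite lte_fin => ds; exists (Num.min ((h - delta) / 2) ((s - 12 * delta) / 3)).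
    rewrite lee_fin; split.
    + by rewrite lt_min; apply/andP; split; lra.
    + by case: (leP ((h - delta) / 2)) => ?; lra.
    + by case: (leP ((h - delta) / 2)) => ?; lra.
  - by move=> _; exists ((h - delta) / 2); split; [lra|lra|exact: leey].
have scale0 : 0 < 4 * delta + tau by lra.
(* Geodesics between points of [U] closer than [2 * delta + tau] stay farther than this from [p], so
   they avoid the support of [theta]. *)
have rho0 : 0 < h - delta - tau / 2 by lra.
have [theta [e [e0 htheta thetaE arms]]] := local_class degp rho0.
pose r := Num.min e (4 * delta + tau).
have r0 : 0 < r by rewrite lt_min e0.
have re : r <= e by rewrite ge_min lexx.
have rscale : r <= 4 * delta + tau by rewrite ge_min lexx orbT.
have hthetar : cocycle setT r theta.
  by move=> x y z _ _ _ xy yz xz; apply: htheta => //; exact: lt_le_trans re.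
have [Th hTh ThE] := extend_cocycle cG gG r0 rscale sys' hthetar.
pose zero (x y : G) := false.
have hzero s : cocycle setT s zero by [].
have Th_nz s : 0 < s -> ~ cohomologous setT s Th zero.
  move=> s0 [c hc]; have sr0 : 0 < Num.min s r by rewrite lt_min s0.
  apply: (local_class_nontrivial delta0 tau0 hfg dth pU nearU sr0 _ arms).
    by move=> x y /thetaE[].
  exists c => x y _ _; rewrite lt_min => /andP[xys xyr].
  by rewrite -(ThE _ _ xyr) hc.
have Th_U u v : U u -> U v -> mdist u v < 2 * delta + tau -> Th u v = false.
  move=> Uu Uv uv; rewrite -(cocyclexx scale0 hTh (x := u))//.
  apply/esym/(between_locally_constant gG (c := Th u) r0) => a b ua ub ab.
  have uab : Th u a (+) Th u b = Th a b.
    by apply: (cocycle_cone hTh) => //; [have := between_le ua|have := between_le ub|]; lra.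
  have : Th a b = false.
    rewrite ThE//; apply/negP => /thetaE[pa _].
    have := metric_triangle p a u; have := metric_triangle p a v.
    have := pU u Uu; have := pU v Uv; move: ua; rewrite /between (metric_sym a u).
    by lra.
  by rewrite -uab; case: (Th u a) (Th u b) => [] [].
have pull_Th : cohomologous setT tau (pull Th) zero.
  exists (fun=> false) => x y _ _ xy; rewrite /zero /=; case: hfg => fU f_lt _ _ _.
  by apply: Th_U => //; have := f_lt x y; lra.
have [F hF] : {F : (G -> G -> bool) -> (G -> G -> bool) & forall phi,
    cocycle setT (4 * delta + tau) phi -> cocycle setT (4 * delta + tau) (F phi) /\
    exists2 s, 0 < s & cohomologous setT s (pull (F phi)) phi}.
  apply: (@choice _ _ (fun phi psi => cocycle setT (4 * delta + tau) phi ->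
    cocycle setT (4 * delta + tau) psi /\
    exists2 s, 0 < s & cohomologous setT s (pull psi) phi)) => phi.
  have [hphi|nphi] := pselect (cocycle setT (4 * delta + tau) phi); last by exists phi.
  have [psi [s [s0 hpsi hs]]] := pull_surjective delta0 tau0 hfg sys' hphi.
  by exists psi => _; split=> //; exists s.
(* Zero comes first because [Th] pulls back to it; thus [S n.+1] pulls back to [S n] for every
   [n]. *)
pose S n := if n is k.+1 then iter k F Th else zero.
have hS n : cocycle setT (4 * delta + tau) (S n).
  by case: n => [|n] //=; elim: n => //= n /hF[].
pose sim phi psi := exists2 s, 0 < s & cohomologous (G := G) setT s phi psi.
have hpull n : sim (pull (S n.+1)) (S n).
  by case: n => [|n]; [exists tau|have [_] := hF _ (hS n.+1)].
have sim_sym phi psi : sim phi psi -> sim psi phi.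
  by move=> [s s0 hs]; exists s => //; apply: cohomologous_sym.
have sim_trans psi phi chi : sim phi psi -> sim psi chi -> sim phi chi.
  move=> [s s0 hs] [t t0 ht]; exists (Num.min s t); first by rewrite lt_min s0.
  apply: (cohomologous_trans (psi := psi)).
    by apply: cohomologousW hs; rewrite ge_min lexx.
  by apply: cohomologousW ht; rewrite ge_min lexx orbT.
have descend phi psi phi' psi' : cocycle setT (4 * delta + tau) phi ->
    cocycle setT (4 * delta + tau) psi -> sim (pull phi) phi' -> sim (pull psi) psi' ->
    sim phi psi -> sim phi' psi'.
  move=> hphi hpsi h1 h2 [s s0 hs]; apply: (sim_trans (pull phi)); first exact: sim_sym.
  apply: (sim_trans (pull psi)) => //.
  by exists tau => //; exact: (cohomologous_pull delta0 hfg s0).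
have [m [l [ml hml]]] := pigeonhole_cocycles cG scale0 hS.
(* Pulling back [m] times on both sides leaves zero and a later term. *)
have {ml hml} [j] : exists j, sim zero (S j.+1).
  exists (l - m.+1)%N; have : sim (S m) (S (m + (l - m.+1).+1)%N).
    have -> : (m + (l - m.+1).+1 = l)%N by rewrite addnS -addSn subnKC.
    by exists ((4 * delta + tau) / 2); first by rewrite divr_gt0.
  elim: m {ml hml} (l - m.+1)%N => [//|m ih] j hm.
  apply: (ih j).
  exact: (descend _ _ _ _ (hS m.+1) (hS (m.+1 + j.+1)%N) (hpull _) (hpull _) hm).
(* Further pullbacks fix zero and lower the other index until it reaches [Th]. *)
elim: j => [|j ih] hj.
  by have [s s0 /cohomologous_sym hs] := hj; exact: (Th_nz s).
apply: ih; apply: (descend _ _ _ _ (hzero _) (hS j.+2) _ (hpull _) hj).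
by exists tau => //; exists (fun=> false).
Qed.

End correspondence.

(** * From the Gromov-Hausdorff distance to near isometries, and the theorem *)

(** [f] and [g] choose partners closer than [delta] in a common ambient space; every estimate makes
    two such jumps. *)
Lemma gromov_hausdorff_near_isometry {R : realType} {G : metricType R} (U : set G)
    (delta : R) : [set: G] !=set0 -> U !=set0 ->
  (gromov_hausdorff_dist [set: G] U < delta%:E)%E ->
  0 < delta /\ exists f g : G -> G, near_isometry U f g delta.
Proof.
move=> [x0 _] [u0 Uu0].
move=> /ereal_inf_lt[_ [Z [A [B [[i [iE iA]] [j [jE jB]] ->]]]]].
rewrite /hausdorff_dist gt_max => /andP[ABlt BAlt].
have approx (C : set Z) a : (edist_inf C a < delta%:E)%E ->
    exists2 c, C c & mdist a c < delta.
  by rewrite edist_infE => /ereal_inf_lt[_ [c Cc <-]]; exists c.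
have fP x : exists u, U u /\ mdist (i x) (j u) < delta.
  have [|b] := approx B (i x).
    apply: le_lt_trans ABlt; apply: ereal_sup_ubound; exists (i x) => //.
    by rewrite -iA; exists x.
  by rewrite -jB => -[u Uu <-]; exists u.
have gP u : exists x, U u -> mdist (i x) (j u) < delta.
  have [Uu|nU] := pselect (U u); last by exists x0.
  have [|a] := approx A (j u).
    apply: le_lt_trans BAlt; apply: ereal_sup_ubound; exists (j u) => //.
    by rewrite -jB; exists u.
  by rewrite -iA => -[x _ <-]; rewrite metric_sym; exists x.
have [f hf] := choice fP; have [g hg] := choice gP.
have i_iso x y : mdist (i x) (i y) = mdist x y by apply: iE; rewrite in_setT.
have j_iso u v : U u -> U v -> mdist (j u) (j v) = mdist u v.
  by move=> Uu Uv; apply: jE; rewrite inE.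
split; first by apply: le_lt_trans (hf x0).2; exact: mdist_ge0.
exists f, g; split.
- by move=> x; have [] := hf x.
- move=> x y; have [Ux fx] := hf x; have [Uy fy] := hf y.
  rewrite -(j_iso _ _ Ux Uy) -(i_iso x y).
  have := metric_triangle (j (f x)) (i x) (j (f y)).
  by have := metric_triangle (i x) (i y) (j (f y)); rewrite (metric_sym (j (f x)) (i x)); lra.
- move=> u v Uu Uv; have gu := hg u Uu; have gv := hg v Uv.
  rewrite -(j_iso _ _ Uu Uv) -(i_iso (g u) (g v)).
  have := metric_triangle (i (g u)) (j u) (i (g v)).
  by have := metric_triangle (j u) (j v) (i (g v)); rewrite (metric_sym (j v)); lra.
- move=> x; have [Ux fx] := hf x; have gx := hg _ Ux; rewrite -i_iso.
  have := metric_triangle (i x) (j (f x)) (i (g (f x))).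
  by rewrite (metric_sym (j _)); lra.
- move=> u Uu; have gu := hg u Uu; have [Uf fg] := hf (g u); rewrite -j_iso//.
  have := metric_triangle (j u) (i (g u)) (j (f (g u))).
  by rewrite (metric_sym (j u) (i _)); lra.
Qed.

Lemma gromov_hausdorff_le_hausdorff {R : realType} {G : metricType R} (U : set G) :
  (gromov_hausdorff_dist [set: G] U <= hausdorff_dist [set: G] U)%E.
Proof.
apply: ereal_inf_lbound; exists G, [set: G], U; split => //.
  by exists id; split=> //; rewrite image_id.
by exists id; split=> //; rewrite image_id.
Qed.

(** Infinite [a] and [s] are covered so that the Gromov-Hausdorff distance and the systole can be
    inserted as they stand. *)
Lemma ereal_between3 {R : realType} (a s : \bar R) (h : R) :
  (a < h%:E)%E -> (a < (12^-1)%:E * s)%E ->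
  exists delta : R, [/\ (a < delta%:E)%E, delta < h & ((12 * delta)%:E < s)%E].
Proof.
case: a => [a| |]; last 2 first.
- by rewrite ltNge leey.
- case: s => [s| |].
  + move=> _ _; exists (Num.min h (s / 12) - 1); rewrite ltNyr; split => //.
      by case: (leP h (s / 12)); lra.
    by rewrite lte_fin; case: (leP h (s / 12)); lra.
  + by move=> _ _; exists (h - 1); rewrite ltNyr ltry; split => //; lra.
  + by rewrite gt0_muleNy ?lte_fin ?invr_gt0.
rewrite lte_fin; case: s => [s| |] ah.
- rewrite -EFinM lte_fin => as_; exists ((a + Num.min h (12^-1 * s)) / 2).
  rewrite !lte_fin; case: (leP h (12^-1 * s)) => ?; split; lra.
- by move=> _; exists ((a + h) / 2); rewrite ltry lte_fin; split => //; lra.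
- by rewrite gt0_muleNy ?lte_fin ?invr_gt0.
Qed.

Theorem theorem1p3 (R : realType) (G : metricType R)
    (hG : finite_connected_metric_graph G)
    (U : set G) (hU : U !=set0)
    (hExt : ~ (extremal_points U `<=` leaves G))
    (hsys : (gromov_hausdorff_dist [set: G] U < (12^-1)%:E * systole G)%E) :
  gromov_hausdorff_dist [set: G] U = hausdorff_dist [set: G] U.
Proof.
have [G0 cG lG deg] := hG; have gG := compact_length_geodesic cG lG.
have [p pExt pleaf] : exists2 p, extremal_points U p & ~ leaves G p.
  apply: contrapT => np; apply: hExt => p pE; apply: contrapT => pl.
  by apply: np; exists p.
apply/eqP; rewrite eq_le gromov_hausdorff_le_hausdorff /= leNgt; apply/negP => lt.
have pdist u : U u -> (hausdorff_dist [set: G] U <= (mdist p u)%:E)%E.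
  by move=> Uu; rewrite -pExt edist_infE; apply: ereal_inf_lbound; exists u.
(* The value lies between 0 and the distance from [p] to a point of [U]. *)
have [h hE] : exists h : R, hausdorff_dist [set: G] U = h%:E.
  have [u0 Uu0] := hU; have := pdist u0 Uu0.
  have : (0 <= hausdorff_dist [set: G] U)%E.
    rewrite -pExt edist_infE; apply: le_ereal_inf_tmp => _ [u _ <-].
    by rewrite lee_fin mdist_ge0.
  by case: (hausdorff_dist _ _) => [h||]//; exists h.
rewrite hE in lt pdist.
have [delta [ltd dh sysd]] := ereal_between3 lt hsys.
have [delta0 [f [g fg]]] := gromov_hausdorff_near_isometry G0 hU ltd.
have nearU y e : 0 < e -> exists2 u, U u & mdist y u < h + e.
  move=> e0; have : (edist_inf U y < (h + e)%:E)%E.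
    apply: (@le_lt_trans _ _ h%:E); last by rewrite lte_fin ltrDl.
    rewrite -hE /hausdorff_dist le_max; apply/orP; left.
    by apply: ereal_sup_ubound; exists y.
  by rewrite edist_infE => /ereal_inf_lt[_ [u Uu <-]]; rewrite lte_fin; exists u.
(* In degree 0 the graph is the point [p], which then lies in [U] and forces [h <= 0]; in degree 1,
   [p] would be a leaf. *)
have [[|[|n]] degp] := deg p.
- have [u Uu] := hU; have := pdist u Uu.
  by rewrite (degree0_trivial u gG degp) mdistxx lee_fin; lra.
- exact: pleaf.
- have dim1 := graph_one_dimensional cG gG deg.
  have := near_isometry_dist_ge cG gG dim1 delta0 fg sysd degp pdist nearU.
  by rewrite leNgt dh.
Qed.
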